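(* Let $(x^k)_{k\ge 0}$ be generated by the ARock algorithm for a nonexpansive operator $T:\mathbb{H}\to\mathbb{H}$ with at least one fixed point. Assume that the block sequence $i(0),i(1),\ldots$ is a sequence of IID random variables, uniform on $\{1,\ldots,m\}$, and that the sequence of delay vectors $\vec{j}(0),\vec{j}(1),\vec{j}(2),\ldots$ is an arbitrary (deterministic) sequence in $\mathbb{N}^m$, independent of the block sequence, with $\liminf_k j(k)<\infty$. Pick arbitrary, fixed $c\in(0,1)$ and $\gamma>0$. Let the step size be $$\eta^k=c\left(1+\frac{1}{\sqrt{m}}\left(1+\frac{1}{\gamma}+\frac{1}{2+\gamma}\,(j(k)+1)^{2+\gamma}\right)\right)^{-1}.$$ Then with probability $1$ there is a solution $x^*\in\mathrm{Fix}(T)$ such that the iterates of ARock converge weakly to $x^*$ on all subsequences of bounded delay $Q_J$ with $J\ge\liminf_k j(k)$, where $x^*$ does not depend on the bound $J$.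
   Context: $\mathbb{H}$ is a separable Hilbert space, decomposed into $m$ orthogonal subspaces $\mathbb{H}=\mathbb{H}_1\times\cdots\times\mathbb{H}_m$; write $x=(x_1,\ldots,x_m)$ with $x_i\in\mathbb{H}_i$. $T:\mathbb{H}\to\mathbb{H}$ is nonexpansive: $\|Tx-Ty\|\le\|x-y\|$. $\mathrm{Fix}(T)$ is its set of fixed points; a solution is an element of $\mathrm{Fix}(T)$. $S=I-T$, and $S_ix$ is the $i$-th block of $Sx$. $\mathbb{N}=\{0,1,2,\ldots\}$. ARock algorithm: given a starting point $x^0\in\mathbb{H}$, step lengths $\eta^0,\eta^1,\ldots$, block indices $i(k)\in\{1,\ldots,m\}$ and delay vectors $\vec{j}(k)=(j(k,1),\ldots,j(k,m))\in\mathbb{N}^m$, define for $k=0,1,2,\ldots$ and $i=1,\ldots,m$: $x_i^{k+1}=x_i^k-\eta^kS_i(\hat{x}^k)$ if $i=i(k)$, and $x_i^{k+1}=x_i^k$ if $i\ne i(k)$. The delayed iterate is $\hat{x}^k=x^{k-\vec{j}(k)}$, where $x^{k-\vec{j}}=(x_1^{k-j_1},\ldots,x_m^{k-j_m})$ and $x^n=x^0$ for $n<0$. The current delay is $j(k)=\max_{1\le i\le m}j(k,i)$. Subsequences of bounded delay: $Q_J$ is the subsequence of $x^0,x^1,x^2,\ldots$ obtained by removing the iterates $x^k$ with current delay $j(k)>J$; for $J\ge\liminf_k j(k)$ it is an infinite subsequence. *)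

(* Defs.v *)
From HB Require Import structures.
From mathcomp Require Import all_boot all_order all_algebra sesquilinear.
From mathcomp Require Import all_classical all_reals all_analysis.
Import Order.TTheory GRing.Theory Num.Theory.
Import numFieldNormedType.Exports.

Set Implicit Arguments.
Unset Strict Implicit.
Unset Printing Implicit Defensive.

Local Open Scope classical_set_scope.
Local Open Scope ring_scope.

(* A real Hilbert space is a complete normed module with a positive definite
   symmetric bilinear form [dot] that induces its norm. *)
Definition inner_product_of_norm (R : realType) (H : completeNormedModType R)
    (dot : {dot H for idfun}) : Prop :=
  forall x : H, `|x| ^+ 2 = dot x x.

Definition separable (X : topologicalType) : Prop :=
  exists A : set X, countable A /\ dense A.

Definition weakly_cvg (R : realType) (H : completeNormedModType R)
    (dot : {dot H for idfun}) (u : nat -> H) (l : H) : Prop :=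
  forall y : H, dot (u n) y @[n --> \oo] --> (dot l y : R).

(* Closedness of the subspaces need not be required: each [V i] is the
   orthogonal complement of the sum of the others. *)
Definition orthogonal_decomposition (R : realType)
    (H : completeNormedModType R) (dot : {dot H for idfun}) (m : nat)
    (V : 'I_m -> set H) : Prop :=
  [/\ forall i, GRing.submod_closed (mem (V i)),
      forall i j, i != j -> forall u v, V i u -> V j v -> dot u v = 0
    & forall x : H, exists y : 'I_m -> H,
        (forall i, V i (y i)) /\ x = \sum_(i < m) y i].

(* The block x_i, seen inside H; the family chosen here is unique when [V] is an
   orthogonal decomposition. *)
Definition block (R : realType) (H : completeNormedModType R) (m : nat)
    (V : 'I_m -> set H) (i : 'I_m) (x : H) : H :=
  xget (fun=> 0)
    [set y : 'I_m -> H | (forall s, V s (y s)) /\ x = \sum_(s < m) y s] i.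

Definition nonexpansive (R : realType) (H : completeNormedModType R)
    (T : H -> H) : Prop :=
  forall x y : H, `|T x - T y| <= `|x - y|.

Definition Fix (H : Type) (T : H -> H) : set H := [set x | T x = x].

Definition current_delay (m : nat) (jv : nat -> 'I_m -> nat) (k : nat) : nat :=
  (\max_(i < m) jv k i)%N.

(* The truncated subtraction implements the convention x^n = x^0 for n < 0. *)
Definition delayed_iterate (R : realType) (H : completeNormedModType R)
    (m : nat) (V : 'I_m -> set H) (jv : nat -> 'I_m -> nat) (x : nat -> H)
    (k : nat) : H :=
  \sum_(i < m) block V i (x (k - jv k i)%N).

Definition arock (R : realType) (H : completeNormedModType R) (m : nat)
    (V : 'I_m -> set H) (T : H -> H) (x0 : H) (eta : nat -> R)
    (ib : nat -> 'I_m) (jv : nat -> 'I_m -> nat) (x : nat -> H) : Prop :=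
  let S z := z - T z in
  x 0%N = x0 /\
  forall (k : nat) (i : 'I_m),
    block V i (x k.+1) =
      if i == ib k
      then block V i (x k) - eta k *: block V i (S (delayed_iterate V jv x k))
      else block V i (x k).

Definition step_size (R : realType) (c gamma : R) (m : nat)
    (jv : nat -> 'I_m -> nat) (k : nat) : R :=
  c * (1 + (Num.sqrt m%:R)^-1 *
           (1 + gamma^-1 +
            (2 + gamma)^-1 *
            ((current_delay jv k)%:R + 1) `^ (2 + gamma)))^-1.

(* Since 'I_m is finite, the sets [B k] range over all its subsets. *)
Definition mutually_independent (R : realType) (d : measure_display)
    (Omega : measurableType d) (P : probability Omega R) (m : nat)
    (X : nat -> Omega -> 'I_m) : Prop :=
  forall (s : seq nat) (B : nat -> set 'I_m), uniq s ->
    (P (\bigcap_(k in [set` s]) (X k @^-1` B k)) =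
     \prod_(k <- s) P (X k @^-1` B k))%E.

Definition iid_uniform (R : realType) (d : measure_display)
    (Omega : measurableType d) (P : probability Omega R) (m : nat)
    (X : nat -> Omega -> 'I_m) : Prop :=
  [/\ forall k i, measurable (X k @^-1` [set i]),
      forall k i, P (X k @^-1` [set i]) = (m%:R^-1)%:E
    & mutually_independent P X].

Definition liminf_nat (R : realType) (j : nat -> nat) : \bar R :=
  limn_einf (fun k => ((j k)%:R)%:E).

(* The n-th (from 0) element of {k | j k <= J}, in increasing order: the unique
   element having exactly n smaller ones. *)
Definition kept_index (j : nat -> nat) (J n : nat) : nat :=
  xget 0%N [set k | (j k <= J)%N /\
                    count (fun l => (j l <= J)%N) (iota 0 k) = n].

Definition bounded_delay_subseq (H : Type) (x : nat -> H) (j : nat -> nat)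
    (J : nat) : nat -> H :=
  fun n => x (kept_index j J n).

(* Main.v *)
(* Write S = I - T. Given a fixed point z, the function
   |x^k - z|^2 + m^(-1/2) * sum_{n<k} C(k-n) |x^(n+1) - x^n|^2, with decreasing lag
   weights C, drops in conditional expectation by at least
   (1 - c) eta^k / m * |S(hat x^k)|^2: cocoercivity of S controls the cross term up to
   |x^k - hat x^k| |S(hat x^k)|, which Young's inequality splits against the decrements
   of C, and the step size is exactly what this costs. Supermartingale convergence then
   shows that almost surely |x^k - z| converges, simultaneously for a countable dense set
   of fixed points and hence for all of them, and that eta^k |S(hat x^k)|^2 is summable.
   Along Q_J the steps are bounded below and the delays bounded above, so S(x^k) -> 0,
   and Opial's argument yields one weak limit for all J.

   Since the block indices are finitely valued, conditional expectations are averages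
   over the m one-step continuations of a finite history, and no integral is needed. *)
Require Import Defs.
From HB Require Import structures.
From mathcomp Require Import all_boot all_order all_algebra sesquilinear.
From mathcomp Require Import all_classical all_reals all_analysis.
From mathcomp Require Import zify ring lra.
Import Order.TTheory GRing.Theory Num.Theory.
Import numFieldNormedType.Exports.

Local Open Scope classical_set_scope.
Local Open Scope ring_scope.

(** * Convergence of nonnegative supermartingales *)

Section crossings.
Context (R : realType).

(* Whether an upcrossing of [[a, b]] is in progress, and the number of those
   completed, before time [k]. *)
Fixpoint crossings (a b : R) (y : nat -> R) (k : nat) : bool * nat :=
  if k is k'.+1 then
    let: (up, n) := crossings a b y k' in
    if up then (if b <= y k' then (false, n.+1) else (true, n))
    else (if y k' <= a then (true, n) else (false, n))
  else (false, 0%N).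

(* The wealth of a gambler who starts with [a], buys when the process is below [a]
   and sells when it is above [b]; along a nonnegative supermartingale it is again a
   nonnegative supermartingale, and it dominates [b - a] times the number of
   upcrossings. *)
Definition wealth (a b : R) (s : bool * nat) (y : R) : R :=
  if s.1 then s.2%:R * (b - a) + y else s.2%:R * (b - a) + a.

(** Buying at [y k <= a] exchanges [a] for [y k], and selling at [y k >= b] credits only [b]. *)
Lemma wealth_crossings_le a b y k :
  wealth a b (crossings a b y k.+1) (y k) <= wealth a b (crossings a b y k) (y k).
Proof.
rewrite /wealth /=; case: (crossings a b y k) => -[] n /=.
  case: (lerP b (y k)) => bk //=.
  by rewrite -natr1 mulrDl mul1r -addrA lerD2l subrK.
by case: (lerP (y k) a) => bk //=; rewrite lerD2l.
Qed.

Lemma crossings_eq a b (y z : nat -> R) k :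
  (forall l, (l < k)%N -> y l = z l) -> crossings a b y k = crossings a b z k.
Proof.
elim: k => //= k IH H; rewrite IH; first by rewrite H.
by move=> l lk; apply: H; rewrite ltnS ltnW.
Qed.

Lemma crossings_unbounded (a b : R) (y : nat -> R) :
  a < b -> (forall n, exists2 k, (n <= k)%N & y k <= a) ->
  (forall n, exists2 k, (n <= k)%N & b <= y k) ->
  forall N, exists k, (N <= (crossings a b y k).2)%N.
Proof.
move=> ab ya yb.
have step k : ((crossings a b y k).2 <= (crossings a b y k.+1).2)%N.
  by rewrite /=; case: (crossings a b y k) => -[] n /=; case: ifP.
have mono k l : (k <= l)%N -> ((crossings a b y k).2 <= (crossings a b y l).2)%N.
  by move=> /subnK <-; elim: (l - k)%N => // j IH; rewrite addSn (leq_trans IH).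
elim=> [|N [k0 Hk0]]; first by exists 0%N.
have [k1 k01 yk1] := ya k0; have [k2 k12 yk2] := yb k1.+1.
have [Hlt|Hle] := ltnP N (crossings a b y k2.+1).2; first by exists k2.+1.
(* If the count does not exceed [N] after [k2], it is frozen at [N] since [k0]; but the visit below
   [a] at [k1] leaves an upcrossing open until [k2] completes it. *)
have E l : (k0 <= l <= k2.+1)%N -> (crossings a b y l).2 = N.
  move=> /andP[l0 l2]; apply/eqP; rewrite eqn_leq (leq_trans (mono _ _ l2))//=.
  by rewrite (leq_trans Hk0)// mono.
have up1 : (crossings a b y k1.+1).1.
  have nb : (b <= y k1) = false by apply/negbTE; rewrite -ltNge (le_lt_trans yk1).
  by rewrite /=; case: (crossings a b y k1) => -[] n /=; rewrite ?nb ?yk1.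
have up2 j : (k1 < j <= k2)%N -> (crossings a b y j).1.
  elim: j => // j IH /andP[kj jk].
  have [<-//|kj'] := eqVneq k1 j.
  have {IH} : (crossings a b y j).1.
    by apply: IH; rewrite (ltnW jk) andbT ltn_neqAle kj'.
  have := E j.+1; have := E j; rewrite /=; case: (crossings a b y j) => -[] n //=.
  case: ifP => //= _ e1 e2; have := e1; have := e2; lia.
have := up2 k2; have := E k2; have := E k2.+1; rewrite /=.
case: (crossings a b y k2) => -[] n /=; last by move=> _ _; rewrite k12 leqnn; lia.
rewrite yk2 => /=; lia.
Qed.

(** A bounded sequence that does not tend to its cluster point [p] is far from [p] infinitely often
    on one side while returning near [p], hence crosses some rational interval infinitely often. *)
Lemma cvgn_of_crossings (y : nat -> R) (B : R) :
  (forall k, 0 <= y k <= B) ->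
  (forall q r : rat, 0 <= ratr q :> R -> ratr q < ratr r :> R ->
     exists N, forall k, ((crossings (ratr q) (ratr r) y k).2 <= N)%N) ->
  cvgn y.
Proof.
move=> yB Hc.
have no_osc (a b : R) : 0 <= a -> a < b -> (forall n, exists2 k, (n <= k)%N & y k <= a) ->
  (forall n, exists2 k, (n <= k)%N & b <= y k) -> False.
  move=> a0 ab ya yb.
  have [|q] := @rat_in_itvoo R a ((a + b) / 2); first by lra.
  rewrite in_itv /= => /andP[q1 q2].
  have [|r] := @rat_in_itvoo R ((a + b) / 2) b; first by lra.
  rewrite in_itv /= => /andP[r1 r2].
  have qr : ratr q < ratr r :> R by lra.
  have q0 : 0 <= ratr q :> R by lra.
  have [N HN] := Hc q r q0 qr.
  have [||k] := crossings_unbounded _ _ y qr _ _ N.+1.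
  - by move=> n; have [k nk yk] := ya n; exists k => //; lra.
  - by move=> n; have [k nk yk] := yb n; exists k => //; lra.
  - by rewrite ltnNge HN.
have sub : (y @ \oo) `[0, B]%classic.
  by exists 0%N => // k _ /=; rewrite in_itv /= yB.
have [p [/= pB clp]] := @segment_compact R 0 B _ (fmap_proper_filter y _) sub.
have p0 : 0 <= p by move: pB; rewrite in_itv /= => /andP[].
have near_p (e : R) : 0 < e -> forall n, exists2 k, (n <= k)%N & `|p - y k| < e.
  move=> e0 n.
  have [||x [[k nk <-] xp]] := clp [set y k | k in [set k | (n <= k)%N]] (ball p e).
  - by exists n => // k nk /=; exists k.
  - exact: nbhsx_ballx.
  - by exists k.
apply/cvg_ex; exists p; apply/cvgrPdist_lt => e e0.
apply: contrapT => far.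
have {}far n : exists2 k, (n <= k)%N & e <= `|p - y k|.
  apply: contrapT => H; apply: far; exists n => // k nk /=.
  by rewrite ltNge; apply/negP => ek; apply: H; exists k.
have [hi|/existsNP[n0 hi]] := pselect (forall n, exists2 k, (n <= k)%N & p + e <= y k).
  apply: (no_osc (p + e / 2) (p + e)) => //; [lra|lra|] => n.
  have [|k nk] := near_p (e / 2) _ n; first by lra.
  by rewrite ltr_distlC => /andP[_ yk]; exists k => //; lra.
have lo n : exists2 k, (n <= k)%N & y k <= p - e.
  have [k nk ek] := far (maxn n n0); exists k; first by rewrite (leq_trans (leq_maxl n n0)).
  have [yk|yk] := lerP (p + e) (y k).
    by case: hi; exists k => //; rewrite (leq_trans (leq_maxr n n0)).
  by move: ek; rewrite ler_normr => /orP[|]; lra.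
apply: (no_osc (p - e) (p - e / 2)) => //; [|lra|].
  by have [k _ yk] := lo 0%N; have /andP[y0 _] := yB k; lra.
move=> n; have [|k nk] := near_p (e / 2) _ n; first by lra.
by rewrite ltr_distlC => /andP[yk _]; exists k => //; lra.
Qed.

End crossings.
Arguments crossings {R} a b y k.
Arguments wealth {R} a b s y.

(** * Maximal inequality and convergence for processes driven by the block draws *)

Section ville.
Context (R : realType) (d : measure_display) (Omega : measurableType d).
Context (P : probability Omega R) (m : nat) (ib : nat -> Omega -> 'I_m).
Hypothesis hib : iid_uniform P ib.

Definition hist (w : Omega) (k : nat) : seq 'I_m := mkseq (ib^~ w) k.

Lemma histS w k : hist w k.+1 = rcons (hist w k) (ib k w).
Proof. exact: mkseqS. Qed.

Lemma size_hist w k : size (hist w k) = k.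
Proof. exact: size_mkseq. Qed.

Lemma hist_eqE w k h : size h = k ->
  (hist w k = h) <-> (forall j, (j < k)%N -> ib j w = nth (ib j w) h j).
Proof.
move=> hk; split=> [<- j jk|H]; first by rewrite nth_mkseq.
apply: (@eq_from_nth _ (ib 0%N w)); first by rewrite size_hist.
move=> j; rewrite size_hist => jk; rewrite nth_mkseq// H//.
by apply: set_nth_default; rewrite hk.
Qed.

Lemma hist_preimage k h i0 : size h = k ->
  [set w | hist w k = h] =
  \bigcap_(j in [set` iota 0 k]) (ib j @^-1` [set nth i0 h j]).
Proof.
move=> hk; apply/seteqP; split=> w /=.
  move=> /(hist_eqE w k h hk) H j /=; rewrite mem_iota add0n => jk /=.
  by rewrite {1}H//; apply: set_nth_default; rewrite hk.
move=> H; apply/hist_eqE => // j jk.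
have /= := H j; rewrite mem_iota add0n => /(_ jk) {1}->.
by apply: set_nth_default; rewrite hk.
Qed.

Lemma measurable_hist k h : measurable [set w | hist w k = h].
Proof.
have [hk|hk] := eqVneq (size h) k; last first.
  rewrite (_ : [set w | _] = set0)//; apply/seteqP; split=> w //= e.
  by move: hk; rewrite -e size_hist eqxx.
case: h hk => [<-|i0 h hk].
  by rewrite (_ : [set w | _] = setT)//; apply/seteqP; split.
rewrite (hist_preimage _ _ i0 hk); apply: bigcap_measurableType => j _.
by case: hib.
Qed.

Lemma prob_hist k h : size h = k ->
  P [set w | hist w k = h] = ((m%:R^-1) ^+ k)%:E.
Proof.
case: hib => _ Pi Pind; case: h => [|i0 h] hk.
  rewrite -hk expr0 -(probability_setT P); congr (P _).
  by apply/seteqP; split.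
rewrite (hist_preimage _ _ i0 hk) Pind ?iota_uniq//.
rewrite (eq_bigr (fun=> (m%:R^-1)%:E)); last by move=> j _; rewrite Pi.
rewrite big_const_seq count_predT size_iota.
by elim: k {hk} => //= n ->; rewrite exprS EFinM.
Qed.

(** Every word has positive probability, so some outcome realises it; without this,
    [block_supermartingale] could hold vacuously. *)
Lemma hist_surj h : exists w, hist w (size h) = h.
Proof.
have [h0|/set0P[w]] := eqVneq [set w | hist w (size h) = h] set0; last by exists w.
have := prob_hist _ h erefl; rewrite h0 measure0 => /esym [] /eqP.
rewrite expf_eq0 invr_eq0 => /andP[]; case: h h0 => // i h _ _.
by rewrite pnatr_eq0 eqn0Ngt (leq_ltn_trans (leq0n _) (ltn_ord i)).
Qed.

Fixpoint words (k : nat) : seq (seq 'I_m) :=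
  if k is k'.+1 then [seq rcons h i | h <- words k', i <- enum 'I_m]
  else [:: [::]].

Lemma mem_words h : h \in words (size h).
Proof.
elim/last_ind: h => //= h i IH; rewrite size_rcons /=.
by apply: allpairs_f => //; rewrite mem_enum.
Qed.

Lemma size_words k h : h \in words k -> size h = k.
Proof.
elim: k h => [|k IH] h /=; first by rewrite inE => /eqP ->.
by move=> /allpairsP[[g i] /= [/IH <- _ ->]]; rewrite size_rcons.
Qed.

(** Divided by [m ^ k], the sum is the expectation of [F] after [k] uniform draws. *)
Lemma sum_words_le (F : seq 'I_m -> R) :
  (forall h, \sum_i F (rcons h i) <= m%:R * F h) ->
  forall k, \sum_(h <- words k) F h <= m%:R ^+ k * F [::].
Proof.
move=> HF; elim=> [|k IH] /=; first by rewrite big_seq1 expr0 mul1r.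
rewrite big_allpairs_dep /=.
apply: (@le_trans _ _ (\sum_(h <- words k) m%:R * F h)).
  by apply: ler_sum => h _; rewrite big_enum.
by rewrite -mulr_sumr exprS -mulrA ler_wpM2l.
Qed.

Lemma measurable_hist_pred k (Q : pred (seq 'I_m)) :
  measurable [set w | Q (hist w k)].
Proof.
rewrite (_ : [set w | _] =
   \bigcup_(h in [set` [seq h <- words k | Q h]]) [set w | hist w k = h]).
  apply: fin_bigcup_measurable => [|h _]; first exact: finite_seq.
  exact: measurable_hist.
apply/seteqP; split=> w /=.
  move=> Qw; exists (hist w k) => //=.
  by rewrite mem_filter Qw -{2}(size_hist w k) mem_words.
by move=> [h /=]; rewrite mem_filter => /andP[Qh _] ->.
Qed.

Lemma prob_hist_pred_le k (Q : pred (seq 'I_m)) :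
  (P [set w | Q (hist w k)] <=
    (\sum_(h <- words k | Q h) (m%:R^-1) ^+ k)%:E)%E.
Proof.
rewrite (_ : [set w | _] = [set w | hist w k \in [seq h <- words k | Q h]]).
  rewrite -big_filter.
  have : all (fun h => size h == k) [seq h <- words k | Q h].
    by apply/allP => h; rewrite mem_filter => /andP[_ /size_words ->].
  elim: [seq _ <- _ | _] => [_|h s IH /= /andP[/eqP hk hs]].
    by rewrite big_nil (_ : [set w | _] = set0) ?measure0//; apply/seteqP; split.
  rewrite big_cons EFinD.
  rewrite (_ : [set w | _] = [set w | hist w k = h] `|`
                             [set w | hist w k \in s]); last first.
    apply/seteqP; split=> w /=; rewrite inE.
      by move=> /orP[/eqP|]; [left|right].
    by move=> [->|->]; rewrite ?eqxx ?orbT.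
  apply: (le_trans (measureU2 _ _ _)).
  - exact: measurable_hist.
  - exact: (measurable_hist_pred _ [pred h | h \in s]).
  - by apply: leeD; [rewrite -(prob_hist k h hk)|exact: IH].
apply/seteqP; split=> w /=; rewrite mem_filter.
  by move=> ->; rewrite -{2}(size_hist w k) mem_words.
by case/andP.
Qed.

Definition block_adapted {T : Type} (f : nat -> Omega -> T) : Prop :=
  forall k w w', hist w k = hist w' k -> f k w = f k w'.

(* The trajectories [v i] are the [m] equally likely one-step continuations of [w],
   so the sum is [m] times a conditional expectation. *)
Definition block_supermartingale (f : nat -> Omega -> R) : Prop :=
  forall k w (v : 'I_m -> Omega),
    (forall i, hist (v i) k.+1 = rcons (hist w k) i) ->
    \sum_i f k.+1 (v i) <= m%:R * f k w.

(* Freezing the process at the level [N] once it has reached it leaves a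
   supermartingale, to which Markov's inequality applies. *)
Lemma prob_reach_le (f : nat -> Omega -> R) (N : R) w0 k :
  0 < N -> (0 < m)%N -> (forall l w, 0 <= f l w) ->
  block_adapted f -> block_supermartingale f ->
  (P [set w | has (fun l => N <= f l w)%R (iota 0 k.+1)] <= (f 0%N w0 / N)%:E)%E.
Proof.
move=> N0 m0 f0 af sf.
(* An outcome chosen for each word turns the process into a function [F] on words; adaptedness makes
   the choice immaterial. *)
pose wit h : Omega := projT1 (cid (hist_surj h)).
have witP h : hist (wit h) (size h) = h by rewrite /wit; case: cid.
pose F h := f (size h) (wit h).
have FE k' w : F (hist w k') = f k' w.
  by rewrite /F size_hist; apply: af; have := witP (hist w k'); rewrite size_hist.
have take_hist w l k' : (l <= k')%N -> take l (hist w k') = hist w l.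
  by move=> lk; rewrite /hist /mkseq -map_take take_iota (minn_idPl lk).
pose hit h := has (fun l => N <= F (take l h)) (iota 0 (size h).+1).
have hitE w : hit (hist w k) = has (fun l => N <= f l w) (iota 0 k.+1).
  rewrite /hit size_hist; apply: eq_in_has => l; rewrite mem_iota add0n ltnS => lk.
  by rewrite take_hist// FE.
have hitS h i : hit (rcons h i) = hit h || (N <= F (rcons h i)).
  rewrite /hit size_rcons -addn1 iotaD has_cat add0n; congr (_ || _); last first.
    by rewrite /= orbF take_oversize// size_rcons.
  apply: eq_in_has => l; rewrite mem_iota add0n ltnS => lk.
  by rewrite -cats1 takel_cat.
pose G h := if hit h then N else F h.
have F0 h : 0 <= F h by exact: f0.
have G0 h : 0 <= G h by rewrite /G; case: ifP => // _; exact: ltW.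
have sG h : \sum_i G (rcons h i) <= m%:R * G h.
  rewrite /G; case: (boolP (hit h)) => hh.
    rewrite (eq_bigr (fun=> N)); last by move=> i _; rewrite hitS hh.
    by rewrite sumr_const card_ord mulr_natl.
  apply: (@le_trans _ _ (\sum_i F (rcons h i))).
    by apply: ler_sum => i _; rewrite hitS (negbTE hh) /=; case: ifP.
  rewrite (eq_bigr (fun i => f (size h).+1 (wit (rcons h i)))); last first.
    by move=> i _; rewrite /F size_rcons.
  by apply: sf => i; rewrite witP -(size_rcons h i) witP.
have -> : [set w | has (fun l => N <= f l w) (iota 0 k.+1)] =
          [set w | hit (hist w k)].
  by apply/seteqP; split=> w /=; rewrite hitE.
apply: (le_trans (prob_hist_pred_le _ _)); rewrite lee_fin.
have mk0 : 0 < m%:R ^+ k :> R by rewrite exprn_gt0// ltr0n.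
(* Markov's inequality: [G h = N] on the words that hit, [G h >= 0] on the others. *)
apply: (@le_trans _ _ ((m%:R^-1) ^+ k / N * \sum_(h <- words k) G h)).
  rewrite mulr_sumr big_mkcond /=; apply: ler_sum => h _; rewrite /G.
  case: ifP => _; first by rewrite divfK// gt_eqF.
  by rewrite mulr_ge0// mulr_ge0 ?invr_ge0 ?(ltW N0)// exprn_ge0// invr_ge0.
apply: (@le_trans _ _ ((m%:R^-1) ^+ k / N * (m%:R ^+ k * G [::]))).
  by rewrite ler_wpM2l ?sum_words_le// mulr_ge0 ?invr_ge0 ?(ltW N0)// exprn_ge0// invr_ge0.
rewrite exprVn [leLHS](_ : _ = G [::] / N); last by field; rewrite ?gt_eqF//= (gt_eqF N0).
rewrite ler_pM2r ?invr_gt0// /G.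
have F00 : F [::] = f 0%N w0 by rewrite /F /=; apply: af.
rewrite -F00 /hit /= orbF; case: ifP => //.
Qed.

(** Letting the horizon grow in [prob_reach_le], the level [n + 1] is ever reached with probability
    at most [f 0 / (n + 1)], so reaching all levels is negligible. *)
Lemma supermartingale_bounded (f : nat -> Omega -> R) :
  (0 < m)%N -> (forall l w, 0 <= f l w) ->
  block_adapted f -> block_supermartingale f ->
  {ae P, forall w, exists B, forall k, f k w <= B}.
Proof.
move=> m0 f0 af sf.
have [w0 _] := hist_surj [::].
pose A (n k : nat) := [set w | has (fun l => n.+1%:R <= f l w) (iota 0 k.+1)].
have mA n k : measurable (A n k).
  have [Q QE] : exists Q : pred (seq 'I_m), forall w,
      has (fun l => n.+1%:R <= f l w) (iota 0 k.+1) = Q (hist w k).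
    exists (fun h => `[< exists2 w, hist w k = h &
      has (fun l => n.+1%:R <= f l w) (iota 0 k.+1) >]) => w.
    apply/idP/asboolP => [?|[w' e] H]; first by exists w.
    rewrite -(eq_in_has (a1 := fun l => n.+1%:R <= f l w'))// => l.
    rewrite mem_iota add0n ltnS => lk; rewrite (af l w w')//.
    by rewrite -(minn_idPl lk) /hist /mkseq -!take_iota !map_take -!/(mkseq _ _) -!/(hist _ _) e.
  rewrite (_ : A n k = [set w | Q (hist w k)]); first exact: measurable_hist_pred.
  by apply/seteqP; split=> w /=; rewrite /A /= -QE.
pose B n := \bigcup_k A n k.
have mB n : measurable (B n) by exact: bigcup_measurable.
have PB n : (P (B n) <= (f 0%N w0 / n.+1%:R)%:E)%E.
  have ndA : nondecreasing_seq (A n).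
    move=> k l kl; apply/subsetPset => w.
    change (has (fun l => n.+1%:R <= f l w) (iota 0 k.+1) ->
            has (fun l => n.+1%:R <= f l w) (iota 0 l.+1)).
    move=> /hasP[j]; rewrite !mem_iota !add0n !ltnS => jk H; apply/hasP; exists j => //.
    by rewrite mem_iota add0n ltnS (leq_trans jk).
  have cA := @nondecreasing_cvg_mu _ _ _ P _ (mA n) (mB n) ndA.
  rewrite -(cvg_lim _ cA)//; apply: lime_le; first by apply/cvg_ex; eexists; exact: cA.
  by apply: nearW => k /=; apply: prob_reach_le.
exists (\bigcap_n B n); split.
- exact: bigcap_measurableType.
- apply/eqP; rewrite eq_le measure_ge0 andbT.
  apply/lee_addgt0Pr => e e0; rewrite add0e.
  pose n := Num.truncn (f 0%N w0 / e).
  apply: (@le_trans _ _ (P (B n))).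
    by rewrite le_measure ?inE//; [exact: bigcap_measurableType|exact: bigcap_inf].
  apply: (le_trans (PB n)); rewrite lee_fin ler_pdivrMr ?ltr0n// mulrC.
  by rewrite -ler_pdivrMr// ltW// truncnS_gt.
- move=> w /= nb n _; apply: contrapT => nB; apply: nb.
  exists n.+1%:R => k; rewrite leNgt; apply/negP => fk; apply: nB.
  exists k => //; suff: has (fun l => n.+1%:R <= f l w) (iota 0 k.+1) by [].
  by apply/hasP; exists k; rewrite ?mem_iota ?add0n ?ltnS ?leqnn// ltW.
Qed.

Lemma crossings_bounded_ae (f : nat -> Omega -> R) (a b : R) :
  (0 < m)%N -> (forall l w, 0 <= f l w) ->
  block_adapted f -> block_supermartingale f -> 0 <= a -> a < b ->
  {ae P, forall w, exists B, forall k, ((crossings a b (f^~ w) k).2 <= B)%N}.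
Proof.
move=> m0 f0 af sf a0 ab.
(* The index [k.+1] lets the gambler trade at the current value: [crossings] at [k] has seen only
   the values before time [k]. *)
pose g k w := wealth a b (crossings a b (f^~ w) k.+1) (f k w).
have hist_le k w w' l : hist w k = hist w' k -> (l <= k)%N -> f l w = f l w'.
  move=> e lk; apply: af; move/(congr1 (take l)): e.
  by rewrite /hist /mkseq -!map_take take_iota (minn_idPl lk).
have g0 k w : 0 <= g k w.
  rewrite /g /wealth; case: ifP => _; rewrite addr_ge0// mulr_ge0// subr_ge0 ltW//.
have ag : block_adapted g.
  move=> k w w' e; rewrite /g (af k w w')//.
  by rewrite (crossings_eq _ _ _ (f^~ w) (f^~ w'))// => l lk; exact: (hist_le k).
have sg : block_supermartingale g.
  move=> k w v hv.
  have hv' i : hist (v i) k = hist w k.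
    by have := hv i; rewrite histS => /rcons_inj[].
  (* The trade at the next time cannot raise the wealth, so the position is kept: one share of [f],
     or constant cash. *)
  apply: (@le_trans _ _ (\sum_i wealth a b (crossings a b (f^~ w) k.+1) (f k.+1 (v i)))).
    apply: ler_sum => i _; rewrite /g.
    rewrite -(crossings_eq _ _ _ (f^~ (v i)) (f^~ w)).
      exact: wealth_crossings_le.
    by move=> l lk; exact: (hist_le k).
  rewrite /g /wealth; case: ifP => _; last by rewrite sumr_const card_ord -[leLHS]mulr_natl.
  rewrite big_split /= sumr_const card_ord [leRHS]mulrDr.
  by apply: lerD; [rewrite -[leLHS]mulr_natl|exact: sf].
have := supermartingale_bounded g m0 g0 ag sg.
apply: filterS => w [B HB].
exists (Num.truncn (B / (b - a))).+1 => -[|k]; first by rewrite leq0n.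
have ba : 0 < b - a by rewrite subr_gt0.
have H : (crossings a b (f^~ w) k.+1).2%:R <= B / (b - a).
  rewrite ler_pdivlMr//; apply: (le_trans _ (HB k)); rewrite /g /wealth.
  by case: ifP => _; rewrite lerDl.
by rewrite ltnW// -(ltr_nat R) (le_lt_trans H)// truncnS_gt.
Qed.

Lemma supermartingale_cvg (f : nat -> Omega -> R) :
  (0 < m)%N -> (forall l w, 0 <= f l w) ->
  block_adapted f -> block_supermartingale f ->
  {ae P, forall w, cvgn (f^~ w)}.
Proof.
move=> m0 f0 af sf.
have bnd := supermartingale_bounded f m0 f0 af sf.
(* Enumerating the rational pairs by [unpickle] leaves a countable union of null sets. *)
have crs : {ae P, forall w, forall n (q r : rat), unpickle n = Some (q, r) ->
    0 <= ratr q :> R -> ratr q < ratr r :> R ->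
    exists N, forall k, ((crossings (ratr q) (ratr r) (f^~ w) k).2 <= N)%N}.
  apply: ae_foralln => n.
  case E : (unpickle n) => [[q r]|]; last exact: aeW.
  have [q0|/negP q0] := boolP (0 <= ratr q :> R); last first.
    by apply: aeW => w q' r' [<- _] /q0.
  have [qr|/negP qr] := boolP (ratr q < ratr r :> R); last first.
    by apply: aeW => w q' r' [<- <-] _ /qr.
  have := crossings_bounded_ae f _ _ m0 f0 af sf q0 qr.
  by apply: filterS => w Hw q' r' [<- <-].
apply: filterS2 bnd crs => w [B HB] Hc.
apply: (@cvgn_of_crossings R _ B) => [k|q r q0 qr]; first by rewrite f0 HB.
by apply: (Hc (pickle (q, r))) => //; rewrite pickleK.
Qed.

End ville.
Arguments hist {d Omega m} ib w k.
Arguments histS {d Omega m} ib w k.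
Arguments block_adapted {d Omega m} ib {T} f.
Arguments block_supermartingale {R d Omega m} ib f.
Arguments supermartingale_cvg {R d Omega P m ib} hib f.

(** * Weak convergence in Hilbert spaces *)

Section hilbert.
Context (R : realType) (H : completeNormedModType R) (dot : {dot H for idfun}).
Hypothesis hdot : inner_product_of_norm dot.

Lemma dotC u v : dot u v = dot v u.
Proof.
by rewrite (hermC dot) expr0 mul1r.
Qed.

Lemma normB_sq u v : `|u - v| ^+ 2 = `|u| ^+ 2 - 2 * dot u v + `|v| ^+ 2.
Proof.
rewrite !hdot linearBl !linearBr /= (dotC v u). ring.
Qed.

Lemma normD_sq u v : `|u + v| ^+ 2 = `|u| ^+ 2 + 2 * dot u v + `|v| ^+ 2.
Proof. by rewrite !hdot linearDl !linearDr /= (dotC v u); ring. Qed.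

Lemma dotZr a u v : dot u (a *: v) = a * dot u v.
Proof. by rewrite linearZr_LR. Qed.

Lemma CauchySchwarz u v : `|dot u v| <= `|u| * `|v|.
Proof.
have [->|v0] := eqVneq v 0; first by rewrite linear0r !normr0 mulr0.
have v0' : 0 < `|v| by rewrite normr_gt0.
rewrite -ler_sqr ?nnegrE ?mulr_ge0// exprMn real_normK ?num_real//.
have := sqr_ge0 `|u - (dot u v / `|v| ^+ 2) *: v|.
rewrite normB_sq dotZr normrZ exprMn real_normK ?num_real//.
set a := dot u v; set b := `|v| in v0' *; set c := `|u|.
have -> : c ^+ 2 - 2 * (a / b ^+ 2 * a) + (a / b ^+ 2) ^+ 2 * b ^+ 2 =
  (c ^+ 2 * b ^+ 2 - a ^+ 2) / b ^+ 2 by field; rewrite gt_eqF.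
by rewrite pmulr_lge0 ?invr_gt0 ?exprn_gt0// subr_ge0.
Qed.

(** The gain [|y - z| ^+ 2 / 4] at the midpoint is what makes asymptotic centres unique. *)
Lemma parallelogram_mid (u y z : H) :
  `|u - 2^-1 *: (y + z)| ^+ 2 =
  (`|u - y| ^+ 2 + `|u - z| ^+ 2) / 2 - `|y - z| ^+ 2 / 4.
Proof.
rewrite !normB_sq normrZ exprMn normD_sq dotZr linearDr /=.
by rewrite (ger0_norm (_ : 0 <= 2^-1))//; field.
Qed.

End hilbert.
Arguments normB_sq {R H dot} hdot u v.
Arguments normD_sq {R H dot} hdot u v.
Arguments CauchySchwarz {R H dot} hdot u v.
Arguments parallelogram_mid {R H dot} hdot u y z.
Arguments dotC {R H} dot u v.

(** * Limits along ultrafilters *)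

Section ultralimits.
Context (R : realType) (U : set_system nat) (UU : UltraFilter U).

(** On a compact segment there is a cluster point, and a cluster point of an ultrafilter is its
    limit. *)
Lemma ultra_cvg (y : nat -> R) (B : R) : (forall n, `|y n| <= B) -> cvg (y @ U).
Proof.
move=> yB.
have sub : (y @ U) `[-B, B]%classic.
  suff: U [set n | y n \in `[- B, B]] by [].
  by apply: filterE => n; rewrite /= in_itv /= -ler_norml.
have [p [_ clp]] := @segment_compact R (-B) B _ (fmap_proper_filter y _) sub.
apply/cvg_ex; exists p => A pA.
have [//|nA] := in_ultra_setVsetC (y @^-1` A) UU.
by have [x []] := clp (~` A) A nA pA.
Qed.

End ultralimits.

(** * Asymptotic centres and Opial's argument *)

Section opial.
Context (R : realType) (H : completeNormedModType R) (dot : {dot H for idfun}).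
Hypothesis hdot : inner_product_of_norm dot.

(* The witness is the asymptotic centre of [u] along [U], the unique minimiser of
   [z |-> lim_U `|u n - z|]; this yields weak compactness and demiclosedness of
   [id - T] in one stroke, without the Riesz representation theorem. *)
Lemma asymptotic_center (U : set_system nat) (UU : UltraFilter U)
    (T : H -> H) (u : nat -> H) (B : R) :
  nonexpansive T -> (forall n, `|u n| <= B) -> `|u n - T (u n)| @[n --> U] --> 0 ->
  exists y, T y = y /\ forall v, dot (u n) v @[n --> U] --> dot y v.
Proof.
move=> hT uB uT.
pose g (z : H) : R := lim (`|u n - z| @[n --> U]).
have cg z : `|u n - z| @[n --> U] --> g z.
  apply: (@ultra_cvg _ _ _ _ (B + `|z|)) => n.
  by rewrite normr_id (le_trans (ler_normB _ _))// lerD.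
have g0 z : 0 <= g z.
  by apply: limr_ge; [exact: cg|apply: nearW => n; exact: normr_ge0].
have gL z z' : g z <= g z' + `|z - z'|.
  have cR : `|u n - z'| + `|z - z'| @[n --> U] --> g z' + `|z - z'|.
    by apply: cvgD; [exact: cg|exact: cvg_cst].
  apply: (ler_cvg_to (cg z) cR); apply: nearW => n.
  by rewrite (distrC z z') (le_trans _ (ler_normD _ _))// subrKA.
have cg2 z : `|u n - z| ^+ 2 @[n --> U] --> g z ^+ 2.
  by rewrite expr2; under eq_fun do rewrite expr2; apply: cvgM; exact: cg.
have g_mid (y z : H) : g (2^-1 *: (y + z)) ^+ 2 = (g y ^+ 2 + g z ^+ 2) / 2 - `|y - z| ^+ 2 / 4.
  have := cg2 (2^-1 *: (y + z)) => /cvg_lim <-//.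
  apply/cvg_lim => //; under eq_fun do rewrite (parallelogram_mid hdot).
  by apply: cvgB; [apply: cvgMr_tmp; apply: cvgD; exact: cg2|exact: cvg_cst].
pose mu := inf (range g).
have has_mu : has_inf (range g).
  by split; [exists (g 0), 0|exists 0 => _ [z _ <-]].
have mu_le z : mu <= g z by apply: ge_inf; [case: has_mu|exists z].
have mu0 : 0 <= mu by apply: lb_le_inf; [case: has_mu|move=> _ [z _ <-]].
(* Near-minimisers are close: [g] at their midpoint is at least [mu], which bounds the gain in
   [g_mid]. *)
have near_min (e : R) (z z' : H) : 0 <= e -> g z <= mu + e -> g z' <= mu + e ->
    `|z - z'| ^+ 2 <= 4 * (e * (2 * mu + e)).
  move=> e0 gz gz'.
  have : mu ^+ 2 <= g (2^-1 *: (z + z')) ^+ 2 by rewrite ler_sqr ?nnegrE.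
  have : g z ^+ 2 <= (mu + e) ^+ 2 by rewrite ler_sqr ?nnegrE// addr_ge0.
  have : g z' ^+ 2 <= (mu + e) ^+ 2 by rewrite ler_sqr ?nnegrE// addr_ge0.
  rewrite g_mid.
  have -> : 4 * (e * (2 * mu + e)) = 4 * ((mu + e) ^+ 2 - mu ^+ 2).
    by ring.
  move: (g z ^+ 2) (g z' ^+ 2) (`|_| ^+ 2) (mu ^+ 2) ((mu + e) ^+ 2) => p q r a b; lra.
pose Phi := filter_from [set e : R | 0 < e] (fun e => [set z | g z < mu + e]).
have FPhi : ProperFilter Phi.
  apply: filter_from_proper => [|e e0].
    apply: filter_from_filter; first by exists 1 => /=.
    move=> e f e0 f0; exists (Num.min e f) => [|z /=]; first by rewrite /= lt_min e0.
    by move=> zz; split; apply: (lt_le_trans zz); rewrite lerD2l ge_min lexx ?orbT.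
  by have [_ [z _ <-] zmu] := inf_adherent e0 has_mu; exists z.
have : cauchy Phi.
  apply/cauchyP => e e0.
  (* As [dl <= 1], the bound of [near_min] is less than [8 * dl * (mu + 1)], hence less than
     [e ^+ 2]. *)
  pose dl := Num.min 1 (e ^+ 2 / (8 * (mu + 1))).
  have dl0 : 0 < dl by rewrite lt_min ltr01 divr_gt0 ?exprn_gt0// mulr_gt0// ltr_wpDl.
  have [_ [z _ <-] zmu] := inf_adherent dl0 has_mu; exists z.
  exists dl => // z' /= z'mu; rewrite -ball_normE /= -ltr_sqr ?nnegrE ?(ltW e0)//.
  apply: (le_lt_trans (near_min dl _ _ _ _ _)); rewrite ?ltW//.
  have dl1 : dl <= 1 by rewrite /dl ge_min lexx.
  have dle : dl * (8 * (mu + 1)) <= e ^+ 2.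
    by rewrite -ler_pdivlMr ?mulr_gt0// ?ltr_wpDl// /dl ge_min lexx orbT.
  nra.
move=> /cauchy_cvgP/cvg_ex[y Phiy].
have gy : g y <= mu.
  apply/ler_addgt0Pr => e e0.
  have e20 : 0 < e / 2 by rewrite divr_gt0.
  have Pb : Phi (ball y (e / 2)) by apply: Phiy; exact: nbhsx_ballx.
  have Pg : Phi [set z | g z < mu + e / 2] by exists (e / 2).
  have [z []] := filter_ex (filterI Pb Pg); rewrite -ball_normE /= => yz zmu.
  by rewrite (le_trans (gL y z))//; lra.
exists y; split.
  (* [T y] is a minimiser too, since [|u n - T y|] exceeds [|u n - y|] by at most [|u n - T (u n)|];
     uniqueness gives [T y = y]. *)
  have gTy : g (T y) <= mu.
    apply: le_trans gy.
    have cR : `|u n - T (u n)| + `|u n - y| @[n --> U] --> 0 + g y.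
      by apply: cvgD; [exact: uT|exact: cg].
    rewrite -[leRHS]add0r; apply: (ler_cvg_to (cg (T y)) cR); apply: nearW => n.
    rewrite (le_trans (ler_distD (T (u n)) _ _))// lerD2l; exact: hT.
  have := near_min 0 y (T y) (lexx _); rewrite !addr0 mul0r mulr0 => /(_ gy gTy).
  rewrite real_exprn_even_le0 ?num_real//= normr_eq0 subr_eq0 => /eqP.
  by [].
move=> v.
have cd : cvg (dot (u n - y) v @[n --> U]).
  apply: (@ultra_cvg _ _ _ _ ((B + `|y|) * `|v|)) => n.
  rewrite (le_trans (CauchySchwarz hdot _ _))// ler_wpM2r//.
  by rewrite (le_trans (ler_normB _ _))// lerD.
pose l : R := lim (dot (u n - y) v @[n --> U]).
have l0 : l = 0.
  (* First-order optimality: this is the change of [g ^+ 2] from the minimiser [y] to [y + t *: v].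
     Taking [t = l / |v| ^+ 2] forces [l = 0]. *)
  have key (t : R) : 0 <= t ^+ 2 * `|v| ^+ 2 - 2 * t * l.
    have c1 : `|u n - (y + t *: v)| ^+ 2 @[n --> U] -->
              mu ^+ 2 - 2 * t * l + t ^+ 2 * `|v| ^+ 2.
      under eq_fun => n.
        rewrite opprD addrA (normB_sq hdot) dotZr normrZ exprMn real_normK ?num_real//.
        rewrite mulrA.
        over.
      have -> : mu = g y by apply/eqP; rewrite eq_le mu_le gy.
      apply: cvgD; last exact: cvg_cst.
      apply: cvgB; first exact: cg2.
      by apply: cvgMl_tmp; exact: cd.
    have e := cvg_unique (@Rhausdorff R) (cg2 (y + t *: v)) c1.
    have : mu ^+ 2 <= g (y + t *: v) ^+ 2 by rewrite ler_sqr ?nnegrE.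
    by rewrite e; lra.
  have [v0|v0] := eqVneq `|v| 0.
    by have := key 1; have := key (-1); rewrite v0; lra.
  have v0' : 0 < `|v| ^+ 2 by rewrite exprn_even_gt0.
  have := key (l / `|v| ^+ 2).
  have -> : (l / `|v| ^+ 2) ^+ 2 * `|v| ^+ 2 - 2 * (l / `|v| ^+ 2) * l =
            - (l ^+ 2 / `|v| ^+ 2) by field.
  rewrite oppr_ge0 pmulr_lle0 ?invr_gt0// real_exprn_even_le0 ?num_real//=.
  by move=> /eqP.
have cl : dot (u n - y) v @[n --> U] --> l by exact: cd.
rewrite (_ : (fun n => _) = (fun n => dot (u n - y) v) \+ cst (dot y v)).
  rewrite -[X in _ --> X]add0r -l0; exact: (cvgD cl (cvg_cst _)).
by apply/funext => n /=; rewrite linearBl /= subrK.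
Qed.

(** By polarisation [dot (x k) (p - q)] is affine in [|x k - q| ^+ 2 - |x k - p| ^+ 2], so it
    converges along the whole sequence; comparing its limit at [p] and at [q] gives
    [|p - q| ^+ 2 = 0]. *)
Lemma weak_limits_eq (T : H -> H) (x : nat -> H) (U U' : set_system nat)
    (f f' : nat -> nat) (p q : H) :
  ProperFilter U -> ProperFilter U' ->
  (forall z, T z = z -> cvg (`|x k - z| @[k --> \oo])) ->
  f @ U --> \oo -> f' @ U' --> \oo -> T p = p -> T q = q ->
  (forall v, dot (x (f n)) v @[n --> U] --> dot p v) ->
  (forall v, dot (x (f' n)) v @[n --> U'] --> dot q v) -> p = q.
Proof.
move=> PU PU' cx fU fU' Tp Tq wp wq.
have sq z : T z = z -> cvg (`|x k - z| ^+ 2 @[k --> \oo]).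
  by move=> /cx h; under eq_fun do rewrite expr2; apply: is_cvgM.
have /cvg_ex[r hr] : cvg (dot (x k) (p - q) @[k --> \oo]).
  have -> : (fun k => dot (x k) (p - q)) =
    (fun k => (`|x k - q| ^+ 2 - `|x k - p| ^+ 2 + (`|p| ^+ 2 - `|q| ^+ 2)) / 2).
    by apply/funext => k; rewrite !(normB_sq hdot) linearBr /=; field.
  apply: is_cvgMr_tmp; apply: is_cvgD; last exact: is_cvg_cst.
  by apply: is_cvgB; exact: sq.
have rp : dot p (p - q) = r.
  apply: (cvg_unique (@Rhausdorff R) (wp (p - q))).
  exact: (cvg_comp f _ fU hr).
have rq : dot q (p - q) = r.
  apply: (cvg_unique (@Rhausdorff R) (wq (p - q))).
  exact: (cvg_comp f' _ fU' hr).
apply/eqP; rewrite -subr_eq0 -normr_eq0 -sqrf_eq0 hdot linearBl /= rp rq subrr//.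
Qed.

(** One weak limit [l] is fixed first. If convergence to [l] failed along some [f], an ultrafilter
    on the failing indices would yield a weak limit fixed by [T], equal to [l] by
    [weak_limits_eq]. *)
Lemma opial (T : H -> H) (x : nat -> H) :
  nonexpansive T -> Fix T !=set0 ->
  (forall z, T z = z -> cvg (`|x k - z| @[k --> \oo])) ->
  exists l, T l = l /\ forall f : nat -> nat, f @ \oo --> \oo ->
    `|x (f n) - T (x (f n))| @[n --> \oo] --> 0 -> weakly_cvg dot (x \o f) l.
Proof.
move=> hT [z0 Tz0] cx.
have [B xB] : exists B, forall k, `|x k| <= B.
  have /cvg_seq_bounded[B0 [_ hB]] := cx z0 Tz0.
  exists (B0 + 1 + `|z0|) => k; rewrite -(subrK z0 (x k)) (le_trans (ler_normD _ _))//.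
  rewrite lerD2r; have /= := hB (B0 + 1) _ k I; rewrite normr_id; apply.
  by rewrite ltrDl.
have center (f : nat -> nat) (U : set_system nat) : UltraFilter U -> \oo `<=` U ->
    `|x (f n) - T (x (f n))| @[n --> \oo] --> 0 ->
    exists y, T y = y /\ forall v, dot (x (f n)) v @[n --> U] --> dot y v.
  move=> UU oU fT; apply: (@asymptotic_center U UU T (x \o f) B hT) => [n|].
    exact: xB.
  by move=> A /fT /oU.
(* If the residuals vanish along no index map, the claim about [f] is vacuous and any fixed point
   serves. *)
have [[f0 f0oo f0T]|no] := pselect (exists2 f : nat -> nat, f @ \oo --> \oo &
    `|x (f n) - T (x (f n))| @[n --> \oo] --> 0); last first.
  by exists z0; split => // f foo fT; case: no; exists f.
have [U0 [UU0 oU0]] := ultraFilterLemma (F := \oo) _.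
have [l [Tl wl]] := center f0 U0 UU0 oU0 f0T.
exists l; split => // f foo fT v A lA; apply: contrapT => nA.
pose G := within (~` [set n | A (dot (x (f n)) v)]) \oo.
have PG : ProperFilter G.
  apply: Build_ProperFilter_ex => Q GQ; apply: contrapT => nQ; apply: nA.
  have GQ' : \forall n \near \oo, ~ A (dot (x (f n)) v) -> Q n by exact: GQ.
  suff : \forall n \near \oo, A (dot (x (f n)) v) by [].
  apply: filterS GQ' => n hn.
  by apply: contrapT => nAn; apply: nQ; exists n; apply: hn.
have [U [UU GU]] := ultraFilterLemma PG.
have oU : \oo `<=` U by move=> Q oQ; apply: GU; apply: filterS oQ => n Qn _.
have [q [Tq wq]] := center f U UU oU fT.
have ql : q = l.
  apply: (@weak_limits_eq T x U U0 f f0 q l) => //.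
  - by move=> Q /foo /oU.
  - by move=> Q /f0oo /oU0.
have UnA : U (~` [set n | A (dot (x (f n)) v)]) by apply: GU; apply: withinT.
have UA : U [set n | A (dot (x (f n)) v)] by apply: (wq v); rewrite ql.
by have [n []] := filter_ex (filterI UnA UA).
Qed.

End opial.

(** * Orthogonal blocks *)

Section blocks.
Context (R : realType) (H : completeNormedModType R) (dot : {dot H for idfun}).
Hypothesis hdot : inner_product_of_norm dot.
Context (m : nat) (V : 'I_m -> set H).
Hypothesis hV : orthogonal_decomposition dot V.
Local Notation block := (block V).

Lemma blockP x : (forall s, V s (block s x)) /\ x = \sum_(s < m) block s x.
Proof.
case: hV => _ _ /(_ x) ex; rewrite /block.
by case: xgetP => [y _ //|/(_ _)]; case: ex => y ? /(_ y).
Qed.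

Lemma block_in s x : V s (block s x).
Proof. by case: (blockP x). Qed.

Lemma sum_block x : \sum_(s < m) block s x = x.
Proof. by case: (blockP x). Qed.

Lemma subspace_lin s a u v : V s u -> V s v -> V s (a *: u + v).
Proof.
case: hV => /(_ s) [_ lin] _ _ Vu Vv.
by have := lin a u v; rewrite !inE; apply.
Qed.

Lemma subspace0 s : V s 0.
Proof. by case: hV => /(_ s) [+ _] _ _; rewrite inE. Qed.

Lemma dot_subspaces i j u v : i != j -> V i u -> V j v -> dot u v = 0.
Proof. by case: hV => _ h _ ij Vu Vv; exact: (h i j ij u v Vu Vv). Qed.

(** The differences [block t x - y t] are mutually orthogonal and sum to [0], so each is orthogonal
    to itself. *)
Lemma block_unique (y : 'I_m -> H) x :
  (forall s, V s (y s)) -> x = \sum_(s < m) y s -> forall s, block s x = y s.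
Proof.
move=> Vy xE s; apply/eqP; rewrite -subr_eq0 -normr_eq0 -sqrf_eq0 hdot.
have Vd t : V t (block t x - y t).
  rewrite addrC -scaleN1r; apply: subspace_lin => //; exact: block_in.
have e0 : \sum_(t < m) (block t x - y t) = 0.
  by rewrite sumrB sum_block -xE subrr.
have : dot (block s x - y s) (\sum_(t < m) (block t x - y t)) = 0.
  by rewrite e0 linear0r.
rewrite linear_sumr (bigD1 s) //= big1 ?addr0; first by move=> ->.
by move=> t ts; apply: (dot_subspaces s t) => //; rewrite eq_sym.
Qed.

Lemma block_lin a u v s : block s (a *: u + v) = a *: block s u + block s v.
Proof.
apply: (block_unique (fun s => a *: block s u + block s v)).
  by move=> t; apply: subspace_lin; exact: block_in.
by rewrite big_split /= -scaler_sumr !sum_block.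
Qed.

Lemma block0 s : block s 0 = 0.
Proof.
apply: (block_unique (fun=> 0)); first by move=> t; exact: subspace0.
by rewrite big1.
Qed.

Lemma blockB u v s : block s (u - v) = block s u - block s v.
Proof. by rewrite addrC -scaleN1r block_lin scaleN1r addrC. Qed.

Lemma block_sum (I : Type) (r : seq I) (Q : pred I) (F : I -> H) s :
  block s (\sum_(i <- r | Q i) F i) = \sum_(i <- r | Q i) block s (F i).
Proof.
apply: (big_morph (block s)) => [u v|]; last exact: block0.
by rewrite -[u]scale1r block_lin !scale1r.
Qed.

Lemma dot_block_block i x y : dot (block i x) (block i y) = dot x (block i y).
Proof.
rewrite -{2}(sum_block x) linear_sumlz (bigD1 i)//= big1 ?addr0// => j ji.
by apply: (dot_subspaces j i) => //; exact: block_in.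
Qed.

Lemma sum_dot_block x y : \sum_(i < m) dot x (block i y) = dot x y.
Proof. by rewrite -linear_sumr sum_block. Qed.

Lemma sum_norm_block x : \sum_(i < m) `|block i x| ^+ 2 = `|x| ^+ 2.
Proof.
by rewrite hdot -sum_dot_block; apply: eq_bigr => i _; rewrite hdot dot_block_block.
Qed.

Lemma norm_block_le i x : `|block i x| <= `|x|.
Proof.
rewrite -ler_sqr ?nnegrE// -(sum_norm_block x) (bigD1 i)//= lerDl.
by apply: sumr_ge0 => j _; exact: sqr_ge0.
Qed.

(** This is [m] times the mean squared distance to [z] after a uniformly drawn block update. *)
Lemma sum_norm_step (z y s : H) (eta : R) :
  \sum_(i < m) `|y - eta *: block i s - z| ^+ 2 =
  m%:R * `|y - z| ^+ 2 - 2 * eta * dot (y - z) s + eta ^+ 2 * `|s| ^+ 2.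
Proof.
under eq_bigr => i _.
  rewrite addrAC (normB_sq hdot) dotZr normrZ exprMn real_normK ?num_real// mulrA.
  over.
rewrite big_split sumrB /= sumr_const card_ord -mulr_sumr -mulr_sumr.
by rewrite -[_ *+ m]mulr_natl sum_dot_block sum_norm_block.
Qed.

End blocks.
Arguments sum_block {R H dot m V} hV x.
Arguments blockB {R H dot} hdot {m V} hV u v s.
Arguments block_sum {R H dot} hdot {m V} hV {I} r Q F s.
Arguments sum_norm_block {R H dot} hdot {m V} hV x.
Arguments norm_block_le {R H dot} hdot {m V} hV i x.
Arguments sum_norm_step {R H dot} hdot {m V} hV z y s eta.

(** Expand the square in [|(y - z) - (y - T y)| <= |y - z|], which is nonexpansiveness at the fixed
    point [z]. *)
Lemma fix_cocoercive (R : realType) (H : completeNormedModType R)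
    (dot : {dot H for idfun}) (T : H -> H) (y z : H) :
  inner_product_of_norm dot -> nonexpansive T -> T z = z ->
  `|y - T y| ^+ 2 / 2 <= dot (y - z) (y - T y).
Proof.
move=> hdot hT Tz.
have : `|T y - z| ^+ 2 <= `|y - z| ^+ 2 by rewrite ler_sqr ?nnegrE// -{1}Tz.
have -> : T y - z = (y - z) - (y - T y) by rewrite opprB [RHS]addrC subrKA.
by rewrite (normB_sq hdot (y - z)); lra.
Qed.

(** * Lag weights and step sizes *)

Section weights.
Context (R : realType).

Lemma ln_le_subr1 (y : R) : 0 < y -> ln y <= y - 1.
Proof.
move=> y0; have h : -1 < y - 1 by lra.
by have := le_ln1Dx h; rewrite addrC subrK.
Qed.

(** Split off one factor [y] and bound the power [p - 1] by [exp t >= 1 + t] and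
    [ln y >= 1 - 1 / y]. *)
Lemma powR_bernoulli (p y : R) : 1 <= p -> 0 < y -> 1 + p * (y - 1) <= y `^ p.
Proof.
move=> p1 y0.
have ln_ge : 1 - y^-1 <= ln y.
  have := ln_le_subr1 y^-1; rewrite invr_gt0 lnV ?posrE// => /(_ y0); lra.
have -> : y `^ p = y * y `^ (p - 1).
  by rewrite -{2}(powRr1 (ltW y0)) -powRD ?(gt_eqF y0)// ?implybT// addrC subrK.
have h1 : 1 + (p - 1) * (1 - y^-1) <= y `^ (p - 1).
  rewrite /powR gt_eqF//; apply: (le_trans _ (expR_ge1Dx _)).
  by rewrite lerD2l ler_wpM2l// subr_ge0.
apply: le_trans (ler_wpM2l (ltW y0) h1).
by rewrite le_eqVlt; apply/orP; left; apply/eqP; field; rewrite gt_eqF.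
Qed.

(** Bernoulli's inequality at [(a + 1) / a]; it replaces an integral comparison on [[a, a + 1]]. *)
Lemma powR_succ_ge (p a : R) : 1 <= p -> 0 < a ->
  p * a `^ (p - 1) <= (a + 1) `^ p - a `^ p.
Proof.
move=> p1 a0.
have y0 : 0 < (a + 1) / a by rewrite divr_gt0// addr_gt0.
have := powR_bernoulli p _ p1 y0.
have -> : (a + 1) `^ p = ((a + 1) / a) `^ p * a `^ p.
  by rewrite -powRM ?(ltW y0) ?(ltW a0)// divfK// gt_eqF.
have -> : a `^ p = a * a `^ (p - 1).
  by rewrite -{2}(powRr1 (ltW a0)) -powRD ?(gt_eqF a0)// ?implybT// addrC subrK.
have q0 : 0 < a `^ (p - 1) by exact: powR_gt0.
move=> h; have := ler_wpM2r (ltW (mulr_gt0 a0 q0)) h.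
have -> : (1 + p * ((a + 1) / a - 1)) * (a * a `^ (p - 1)) =
   a * a `^ (p - 1) + p * a `^ (p - 1) by field; rewrite gt_eqF.
lra.
Qed.

Lemma powR_pred_ge (g a : R) : 0 < g -> 0 < a ->
  g * ((a + 1) `^ (1 + g))^-1 <= (a `^ g)^-1 - ((a + 1) `^ g)^-1.
Proof.
move=> g0 a0.
have a1 : 0 < a + 1 by rewrite addr_gt0.
pose y := a / (a + 1).
have y0 : 0 < y by rewrite divr_gt0.
have ln_le := ln_le_subr1 y y0.
have -> : (a `^ g)^-1 = y `^ (- g) * ((a + 1) `^ g)^-1.
  by rewrite powRN -invfM -powRM ?(ltW y0) ?(ltW a1)// /y divfK// gt_eqF.
have h : 1 + g * (1 - y) <= y `^ (- g).
  rewrite /powR (gt_eqF y0); apply: (le_trans _ (expR_ge1Dx _)).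
  by rewrite lerD2l mulNr -mulrN ler_wpM2l ?(ltW g0)//; lra.
have q0 : 0 < ((a + 1) `^ g)^-1 by rewrite invr_gt0 powR_gt0.
have := ler_wpM2r (ltW q0) h.
have -> : (a + 1) `^ (1 + g) = (a + 1) * (a + 1) `^ g.
  by rewrite -{2}(powRr1 (ltW a1)) -powRD ?(gt_eqF a1)// implybT.
have -> : 1 - y = (a + 1)^-1 by rewrite /y; field; rewrite gt_eqF.
rewrite invfM mulrDl mul1r mulrA; lra.
Qed.

(* [lag_weight g l] is an explicit majorant of the sum of [t ^ -(1 + g)] over
   [t >= l]. The bracket [1 + 1/g + (j + 1)^(2 + g) / (2 + g)] of the step size
   bounds [lag_weight g 1] plus the sum of [(lag_decay g l)^-1] over [1 <= l <= j]. *)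
Definition lag_weight (g : R) (l : nat) : R :=
  if (l <= 1)%N then 1 + g^-1 else g^-1 * ((l.-1)%:R `^ g)^-1.

Definition lag_decay (g : R) (l : nat) : R := (l%:R `^ (1 + g))^-1.

Lemma lag_decay_gt0 g l : (0 < l)%N -> 0 < lag_decay g l.
Proof. by move=> l0; rewrite invr_gt0 powR_gt0// ltr0n. Qed.

Lemma lag_weight_ge0 g l : 0 < g -> 0 <= lag_weight g l.
Proof.
move=> g0; rewrite /lag_weight; case: ifP => _.
  by rewrite addr_ge0// invr_ge0 ltW.
by rewrite mulr_ge0 ?invr_ge0 ?powR_ge0// ltW.
Qed.

(** For [l = 1] this is an equality, thanks to the summand [1] in [1 + g^-1]; for larger [l] it is
    [powR_pred_ge] at [l - 1]. *)
Lemma lag_weight_decr g l : 0 < g -> (0 < l)%N ->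
  lag_decay g l <= lag_weight g l - lag_weight g l.+1.
Proof.
move=> g0; case: l => // -[|l] _; rewrite /lag_weight /lag_decay /=.
  by rewrite !powR1 invr1 mulr1; lra.
have := powR_pred_ge _ l.+1%:R g0 (ltr0Sn _ _); rewrite natr1.
by rewrite -mulrBr mulrC -ler_pdivlMr// mulrC.
Qed.

Lemma lag_weight_le g l : 0 < g -> lag_weight g l.+1 <= lag_weight g l.
Proof.
move=> g0; case: l => [|l]; first exact: lexx.
rewrite -subr_ge0 (le_trans _ (lag_weight_decr _ _ g0 _))// ltW//.
exact: lag_decay_gt0.
Qed.

Lemma sum_inv_lag_decay g k J : 0 < g ->
  \sum_(n < k | (n < J)%N) (lag_decay g n.+1)^-1 <=
  (2 + g)^-1 * (J%:R + 1) `^ (2 + g).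
Proof.
move=> g0; have p0 : 0 < 2 + g by rewrite addr_gt0.
(* [minn k J] is the number of terms, so the induction on [k] telescopes [powR_succ_ge]. *)
suff h : \sum_(n < k | (n < J)%N) (lag_decay g n.+1)^-1 <=
    (2 + g)^-1 * ((minn k J)%:R + 1) `^ (2 + g).
  apply: (le_trans h); rewrite ler_wpM2l ?invr_ge0 ?(ltW p0)//.
  by rewrite ge0_ler_powR ?nnegrE ?(ltW p0)// ?lerD2r ?ler_nat ?geq_minr// ltr_wpDl.
elim: k => [|k IH].
  by rewrite big_ord0 mulr_ge0 ?invr_ge0 ?powR_ge0// ltW.
rewrite big_mkcond big_ord_recr /= -big_mkcond /=.
case: ltnP => kJ; last first.
  by rewrite addr0 (le_trans IH)// (minn_idPr kJ) (minn_idPr (leqW kJ)).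
rewrite (minn_idPl kJ) (minn_idPl (ltnW kJ)) in IH *.
apply: (le_trans (lerD IH (lexx _))).
rewrite /lag_decay invrK -lerBrDl -mulrBr -ler_pdivrMl ?invr_gt0// invrK.
have := powR_succ_ge (2 + g) (k.+1)%:R _ (ltr0Sn _ _).
rewrite (_ : 2 + g - 1 = 1 + g); last by ring.
rewrite [k%:R + 1]natr1; apply; lra.
Qed.

End weights.

(** Reindexing by the lag [l.+1 = k - n]. *)
Lemma sum_window (W : nmodType) (F : nat -> W) k J :
  \sum_(n < k | (k - J <= n)%N) F n = \sum_(l < k | (l < J)%N) F (k - l.+1)%N.
Proof.
rewrite (reindex_inj rev_ord_inj) /=; apply: eq_bigl => l.
have := ltn_ord l; lia.
Qed.

(** * Bounds on the step size in terms of the delay *)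

Section step_size.
Context (R : realType) (m : nat) (c g : R) (jv : nat -> 'I_m -> nat).
Hypotheses (hc : 0 < c < 1) (g0 : 0 < g) (m0 : (0 < m)%N).

Definition step_denom (J : nat) : R :=
  1 + (Num.sqrt m%:R)^-1 *
      (1 + g^-1 + (2 + g)^-1 * (J%:R + 1) `^ (2 + g)).

Lemma sqrt_dim_gt0 : 0 < Num.sqrt m%:R :> R.
Proof. by rewrite sqrtr_gt0 ltr0n. Qed.

Lemma step_sizeE k : step_size c g jv k = c / step_denom (current_delay jv k).
Proof. by []. Qed.

Lemma step_denom_ge1 J : 1 <= step_denom J.
Proof.
rewrite lerDl mulr_ge0 ?invr_ge0 ?sqrtr_ge0//.
rewrite addr_ge0 ?addr_ge0 ?invr_ge0 ?(ltW g0)//.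
by rewrite mulr_ge0 ?powR_ge0// invr_ge0 addr_ge0// ltW.
Qed.

Lemma step_denom_gt0 J : 0 < step_denom J.
Proof. exact: lt_le_trans ltr01 (step_denom_ge1 J). Qed.

Lemma step_denom_le J J' : (J <= J')%N -> step_denom J <= step_denom J'.
Proof.
move=> JJ; have p0 : 0 <= 2 + g by rewrite addr_ge0// ltW.
rewrite lerD2l ler_wpM2l ?invr_ge0 ?sqrtr_ge0// lerD2l ler_wpM2l ?invr_ge0//.
by rewrite ge0_ler_powR ?nnegrE// ?lerD2r ?ler_nat.
Qed.

Lemma step_size_gt0 k : 0 < step_size c g jv k.
Proof. by rewrite step_sizeE divr_gt0 ?step_denom_gt0//; case/andP: hc. Qed.

Lemma step_size_le1 k : step_size c g jv k <= 1.
Proof.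
rewrite step_sizeE ler_pdivrMr ?step_denom_gt0// mul1r.
by rewrite (le_trans _ (step_denom_ge1 _))// ltW//; case/andP: hc.
Qed.

Lemma step_size_ge k J :
  (current_delay jv k <= J)%N -> c / step_denom J <= step_size c g jv k.
Proof.
move=> kJ; rewrite step_sizeE ler_wpM2l//; first by case/andP: hc => /ltW.
by rewrite lef_pV2 ?posrE ?step_denom_gt0// step_denom_le.
Qed.

End step_size.

(** * Sums, dense sequences and kept indices *)

Lemma sqr_cvg0 (R : realType) (I : Type) (F : set_system I) (FF : Filter F) (u : I -> R) :
  (forall n, 0 <= u n) -> u n ^+ 2 @[n --> F] --> 0 -> u n @[n --> F] --> 0.
Proof.
move=> u0 hu.
rewrite (_ : (fun n => u n) = (fun n => Num.sqrt (u n ^+ 2))).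
  have := cvg_comp (fun n => u n ^+ 2) _ hu (@sqrt_continuous R 0).
  by rewrite sqrtr0.
by apply/funext => n; rewrite sqrtr_sqr ger0_norm.
Qed.

Lemma bounded_sum_cvg (R : realType) (u : nat -> R) (B : R) :
  (forall n, 0 <= u n) -> (forall k, \sum_(n < k) u n <= B) ->
  cvgn (fun k => \sum_(n < k) u n) /\ u n @[n --> \oo] --> 0.
Proof.
move=> u0 uB.
have c : cvgn (fun k => \sum_(n < k) u n).
  apply: nondecreasing_is_cvgn.
    apply/nondecreasing_seqP => k; rewrite big_ord_recr /= lerDl//.
  by exists B => _ [k _ <-].
split=> //; apply: cvg_series_cvg_0.
rewrite (_ : series u = fun k => \sum_(n < k) u n)//.
by apply/funext => k; rewrite /series /= big_mkord.
Qed.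

(* The weighted sum is [w 0] times the partial sum of [u] minus a bounded
   nondecreasing sequence. *)
Lemma weighted_sum_cvg (R : realType) (w u : nat -> R) (B : R) :
  (forall l, 0 <= w l) -> (forall l, w l.+1 <= w l) ->
  (forall n, 0 <= u n) -> (forall k, \sum_(n < k) u n <= B) ->
  cvgn (fun k => \sum_(n < k) w (k - n)%N * u n).
Proof.
move=> w0 wS u0 uB.
have wle l : w l <= w 0%N by elim: l => // l; exact: le_trans.
pose A k := \sum_(n < k) (w 0%N - w (k - n)%N) * u n.
have cA : cvgn A.
  apply: nondecreasing_is_cvgn.
    apply/nondecreasing_seqP => k; rewrite /A big_ord_recr /= -[leLHS]addr0 lerD//.
      apply: ler_sum => n _; rewrite ler_wpM2r// lerB// subSn//; exact: ltnW.
    by rewrite mulr_ge0// subr_ge0.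
  exists (w 0%N * B) => _ [k _ <-].
  apply: (@le_trans _ _ (w 0%N * \sum_(n < k) u n)); last exact: ler_wpM2l.
  rewrite mulr_sumr; apply: ler_sum => n _; rewrite ler_wpM2r//.
  by rewrite lerBlDr lerDl.
have [cu _] := bounded_sum_cvg R u B u0 uB.
rewrite (_ : (fun k => _) = (fun k => w 0%N * \sum_(n < k) u n - A k)).
  by apply: is_cvgB => //; exact: is_cvgMl_tmp.
apply/funext => k; rewrite /A mulr_sumr -sumrB; apply: eq_bigr => n _; ring.
Qed.

(** Points of the dense set [D] may lie outside [A], so each point of [D] and radius [1 / (k + 1)]
    select a point of [A] in that ball, or the default [a0] if there is none. *)
Lemma separable_dense_seq (R : realType) (H : completeNormedModType R) (A : set H) :
  separable H -> A !=set0 ->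
  exists z : nat -> H, (forall n, A (z n)) /\
    forall a (e : R), A a -> 0 < e -> exists n, `|a - z n| < e.
Proof.
move=> [D [cD dD]] [a0 Aa0].
have [h hinj] : exists h : H -> nat, {in D &, injective h}.
  by case/countable_injP : cD => h hinj; exists h.
pose Q (p : nat * nat) := [set a | A a /\
  exists d, [/\ D d, h d = p.1 & `|a - d| < (p.2.+1%:R)^-1]].
pose z n := xget a0 (Q (odflt (0%N, 0%N) (unpickle n))).
exists z; split=> [n|a e Aa e0].
  by rewrite /z; case: xgetP => [y _ []|].
pose k := Num.truncn (2 / e).
have k2 : (k.+1%:R)^-1 < e / 2.
  by rewrite invf_plt ?posrE ?divr_gt0// invf_div; exact: truncnS_gt.
have ko : 0 < (k.+1%:R)^-1 :> R by rewrite invr_gt0.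
have [d []] := dD (ball a (k.+1%:R)^-1) (ex_intro _ a (ballxx a ko)) (ball_open _ _).
rewrite -ball_normE /= => ad Dd.
exists (pickle (h d, k)); rewrite /z pickleK /=.
have Qa : Q (h d, k) a by split => //; exists d.
case: xgetP => [y _ [Ay [d' [Dd' hd' yd]]]|/(_ a)//].
have dd : d' = d by apply: hinj; rewrite ?inE.
rewrite dd /= in yd; apply: (le_lt_trans (ler_distD d a y)).
by rewrite (distrC d y) [e]splitr ltrD// (lt_trans _ k2).
Qed.

(** [|x k - a|] and [|x k - z n|] differ by at most [|a - z n|], uniformly in [k], so the distances
    to [a] are Cauchy. *)
Lemma dist_cvg_dense (R : realType) (H : completeNormedModType R) (A : set H)
    (x z : nat -> H) :
  (forall a (e : R), A a -> 0 < e -> exists n, `|a - z n| < e) ->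
  (forall n, cvg (`|x k - z n| @[k --> \oo])) ->
  forall a, A a -> cvg (`|x k - a| @[k --> \oo]).
Proof.
move=> dz cz a Aa; apply/cauchy_cvgP/cauchyP => e e0.
have e4 : 0 < e / 4 by rewrite divr_gt0.
have [n an] := dz a (e / 4) Aa e4.
have /cvg_ex[l hl] := cz n.
exists l; move/cvgrPdist_lt : hl => /(_ _ e4).
apply: filterS => k; rewrite -ball_normE /= => lk.
have := ler_dist_dist (x k - z n) (x k - a).
have -> : x k - z n - (x k - a) = a - z n by rewrite opprB [LHS]addrC subrKA.
move=> h.
have := ler_distD `|x k - z n| l `|x k - a|; lra.
Qed.

(** * Enumeration of the iterates of bounded delay *)

Section kept.
Context (j : nat -> nat) (J : nat).
Hypothesis infJ : forall N, exists2 k, (N <= k)%N & (j k <= J)%N.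

Let cnt k := count (fun l => (j l <= J)%N) (iota 0 k).

(** [cnt] starts at [0], has steps of at most one and is unbounded, so it takes the value [n], and
    keeps it up to the next kept index. *)
Lemma kept_index_ex n : exists k, (j k <= J)%N /\ cnt k = n.
Proof.
have cntS k : cnt k.+1 = (cnt k + (j k <= J))%N.
  by rewrite /cnt -addn1 iotaD count_cat /= add0n addn0.
suff h : exists k, cnt k = n.
  have [k0 hk0] := h.
  have [k1 k01 jk1] := infJ k0.
  have ex : exists k, (k0 <= k)%N && (j k <= J)%N by exists k1; rewrite k01.
  case: (ex_minnP ex) => k /andP[k0k jk] min.
  exists k; split => //; rewrite -hk0.
  have : forall l, (k0 + l <= k)%N -> cnt (k0 + l) = cnt k0.
    elim=> [|l IH] kl; first by rewrite addn0.
    rewrite addnS cntS IH; last by rewrite ltnW// -addnS.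
    case: (boolP (j (k0 + l) <= J)%N) => jl; last by rewrite addn0.
    have := min (k0 + l)%N; rewrite leq_addr jl => /(_ isT); lia.
  by move=> /(_ (k - k0)%N); rewrite subnKC//; apply.
elim: n => [|n [k hk]]; first by exists 0%N.
have [k1 k01 jk1] := infJ k.
have ex : exists k', (k <= k')%N && (j k' <= J)%N by exists k1; rewrite k01.
have mono l l' : (l <= l')%N -> (cnt l <= cnt l')%N.
  by move=> /subnK <-; elim: (l' - l)%N => // i IH; rewrite addSn cntS (leq_trans IH)// leq_addr.
have ex2 : exists k', (n.+1 <= cnt k')%N.
  by exists k1.+1; rewrite cntS jk1 addn1 ltnS -hk mono.
case: (ex_minnP ex2) => -[|k2] hk2 min; first by [].
exists k2.+1; apply/eqP; rewrite eqn_leq hk2 andbT.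
have : ~~ (n < cnt k2)%N by apply/negP => /min; rewrite ltnn.
by rewrite cntS; case: (j k2 <= J)%N; rewrite -leqNgt; lia.
Qed.

Lemma kept_indexP n : (j (kept_index j J n) <= J)%N /\ cnt (kept_index j J n) = n.
Proof.
rewrite /kept_index; case: xgetP => [k _ //|no].
by have [k hk] := kept_index_ex n; case: (no k).
Qed.

Lemma kept_index_cvg : kept_index j J @ \oo --> \oo.
Proof.
move=> A [N _ NA]; exists N => // n /= Nn; apply: NA => /=.
rewrite (leq_trans Nn)//; have [_ {1}<-] := kept_indexP n.
by rewrite (leq_trans (count_size _ _))// size_iota.
Qed.

End kept.

(** Delays are integers: if they eventually exceeded [J], their lower limit would be at least
    [J + 1]. *)
Lemma frequently_le_of_liminf (R : realType) (j : nat -> nat) (J : nat) :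
  (liminf_nat R j <= (J%:R)%:E)%E -> forall N, exists2 k, (N <= k)%N & (j k <= J)%N.
Proof.
move=> hJ N; apply: contrapT => no.
suff : ((J.+1%:R)%:E <= liminf_nat R j)%E.
  by move=> /le_trans /(_ hJ); rewrite lee_fin ler_nat ltnn.
rewrite /liminf_nat limn_einf_lim; apply: lime_ge; first exact: is_cvg_einfs.
exists N => // n /= Nn; apply/ereal_infP => _ [k /= nk <-].
rewrite lee_fin ler_nat ltnNge; apply/negP => jk; apply: no; exists k => //.
exact: leq_trans nk.
Qed.

Lemma sum_ord_cond_le (R : realType) (F : nat -> R) (k J J' : nat) :
  (forall l, 0 <= F l) -> (J <= J')%N ->
  \sum_(l < k | (l < J)%N) F l <= \sum_(l < J') F l.
Proof.
move=> F0 JJ.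
rewrite (big_ord_widen_cond (k + J') (fun l => l < J)%N F (leq_addr _ _)).
rewrite (big_ord_widen (k + J') F (leq_addl _ _)).
rewrite big_mkcond [leRHS]big_mkcond; apply: ler_sum => l _.
have [lJ|_] := ltnP l J; last by case: ifP.
by rewrite (leq_trans lJ JJ); case: ifP.
Qed.

(** * The Lyapunov function of ARock *)

Section path.
Context (R : realType) (H : completeNormedModType R) (dot : {dot H for idfun}).
Hypothesis hdot : inner_product_of_norm dot.
Context (m : nat) (V : 'I_m -> set H).
Hypothesis hV : orthogonal_decomposition dot V.
Context (T : H -> H) (x0 : H) (eta : nat -> R) (b : nat -> 'I_m).
Context (jv : nat -> 'I_m -> nat) (x : nat -> H).
Hypothesis hT : nonexpansive T.
Hypothesis hx : arock V T x0 eta b jv x.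
Local Notation block := (block V).

Definition residual (k : nat) : H :=
  delayed_iterate V jv x k - T (delayed_iterate V jv x k).

Definition increment (k : nat) : H := x k.+1 - x k.

Lemma block_increment i k :
  block i (increment k) = if i == b k then - (eta k *: block i (residual k)) else 0.
Proof.
rewrite (blockB hdot hV); case: hx => _ /(_ k i) ->; case: ifP => _.
  by rewrite addrC addKr.
by rewrite subrr.
Qed.

Lemma incrementE k : increment k = - (eta k *: block (b k) (residual k)).
Proof.
rewrite -{1}(sum_block hV (increment k)) (bigD1 (b k))//= block_increment eqxx.
by rewrite big1 ?addr0// => i ib; rewrite block_increment (negbTE ib).
Qed.

Lemma arock_step k : x k.+1 = x k - eta k *: block (b k) (residual k).
Proof. by rewrite -incrementE addrC subrK. Qed.

Lemma norm_increment_le k : `|increment k| <= `|eta k| * `|residual k|.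
Proof. by rewrite incrementE normrN normrZ ler_wpM2l// (norm_block_le hdot hV). Qed.

(** Telescoping in each block over its own delay and exchanging sums counts each increment at most
    once, as it lies in the single block [b n]; hence no factor [m]. *)
Lemma delay_error_le k :
  `|x k - delayed_iterate V jv x k| <=
  \sum_(n < k | (k - current_delay jv k <= n)%N) `|increment n|.
Proof.
have -> : x k - delayed_iterate V jv x k =
    \sum_(n < k) \sum_(i < m | (k - jv k i <= n)%N) block i (increment n).
  rewrite -{1}(sum_block hV (x k)) /delayed_iterate -sumrB.
  rewrite [RHS](exchange_big_dep xpredT)//=; apply: eq_bigr => i _.
  rewrite -(blockB hdot hV) -(block_sum hdot hV); congr (block i _).
  rewrite -(telescope_sumr x (leq_subr (jv k i) k)) big_nat_cond big_mkcond.
  rewrite -[RHS](big_mkord (fun n => k - jv k i <= n)%N (fun n => increment n)).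
  rewrite [RHS]big_mkcond /=.
  rewrite [RHS](@big_cat_nat _ _ _ (k - jv k i)%N)//= ?leq_subr//.
  rewrite [X in _ = X + _]big1_seq ?add0r; last first.
    move=> n /andP[_]; rewrite mem_index_iota => /andP[_ nk]; rewrite leqNgt nk//.
  rewrite big_nat_cond [RHS]big_nat_cond; apply: eq_bigr => n.
  by rewrite andbT => /andP[nk1 nk2]; rewrite nk1 nk2.
apply: (le_trans (ler_norm_sum _ _ _)).
rewrite [leRHS]big_mkcond /=; apply: ler_sum => n _.
have [kn|kn] := boolP (k - jv k (b n) <= n)%N.
  have -> : (k - current_delay jv k <= n)%N.
    by rewrite (leq_trans _ kn)// leq_sub2l// (@leq_bigmax _ (jv k) (b n)).
  rewrite (bigD1 (b n))//= [X in _ + X]big1 ?addr0.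
    exact: norm_block_le hV _ _.
  by move=> i /andP[_ ib]; rewrite block_increment (negbTE ib).
rewrite big1 ?normr0; first by case: ifP.
move=> i ki; rewrite block_increment; case: eqP => // ib.
by move: kn; rewrite -ib ki.
Qed.

(** The left side is [m] times the mean change caused by the new iterate and its lag-one increment,
    plus the decrease to be secured; the decrements of the lag weights will cover the right side. *)
Lemma descent (c g : R) (z : H) (k : nat) :
  0 < c < 1 -> 0 < g -> (0 < m)%N -> T z = z -> eta = step_size c g jv ->
  - (2 * eta k * dot (x k - z) (residual k)) +
    eta k ^+ 2 * `|residual k| ^+ 2 * (1 + (Num.sqrt m%:R)^-1 * (1 + g^-1)) +
    (1 - c) * (eta k * `|residual k| ^+ 2) <=
  Num.sqrt m%:R * \sum_(n < k) lag_decay R g (k - n) * `|increment n| ^+ 2.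
Proof.
move=> hc g0 m0 Tz etaE.
set q := Num.sqrt m%:R; have q0 : 0 < q by exact: sqrt_dim_gt0.
set s := residual k; set e := eta k; set J := current_delay jv k.
have e0 : 0 < e by rewrite /e etaE step_size_gt0.
have Hdot : - (2 * e * dot (x k - z) s) <=
    - (e * `|s| ^+ 2) + 2 * e * `|s| * `|x k - delayed_iterate V jv x k|.
  have h1 : `|s| ^+ 2 / 2 <= dot (delayed_iterate V jv x k - z) s.
    exact: fix_cocoercive.
  have h2 := CauchySchwarz hdot (x k - delayed_iterate V jv x k) s.
  have -> : dot (x k - z) s = dot (delayed_iterate V jv x k - z) s +
      dot (x k - delayed_iterate V jv x k) s.
    by rewrite -linearDl /= (addrC (delayed_iterate _ _ _ _ - z)) subrKA.
  move: h2; rewrite ler_norml => /andP[h2 _].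
  have h3 : `|s| ^+ 2 / 2 - `|x k - delayed_iterate V jv x k| * `|s| <=
     dot (delayed_iterate V jv x k - z) s + dot (x k - delayed_iterate V jv x k) s by lra.
  have := ler_wpM2l (ltW e0) h3.
  set d := `|x k - _|; set D := (dot _ _ + dot _ _); lra.
have Hyoung n : (n < k)%N -> 2 * e * `|s| * `|increment n| <=
    q * (lag_decay R g (k - n) * `|increment n| ^+ 2) +
    e ^+ 2 * `|s| ^+ 2 * (q^-1 * (lag_decay R g (k - n))^-1).
  move=> nk; have l0 : 0 < lag_decay R g (k - n) by rewrite lag_decay_gt0// subn_gt0.
  set l := lag_decay R g (k - n) in l0 *; set d := `|increment n|; set t := `|s|.
  rewrite -subr_ge0.
  have -> : q * (l * d ^+ 2) + e ^+ 2 * t ^+ 2 * (q^-1 * l^-1) - 2 * e * t * d =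
    (q * l * d - e * t) ^+ 2 * (q^-1 * l^-1) by field; rewrite !gt_eqF.
  by rewrite mulr_ge0 ?sqr_ge0// mulr_ge0// invr_ge0 ltW.
have Hsum : 2 * e * `|s| * `|x k - delayed_iterate V jv x k| <=
    q * (\sum_(n < k) lag_decay R g (k - n) * `|increment n| ^+ 2) +
    e ^+ 2 * `|s| ^+ 2 * (q^-1 * ((2 + g)^-1 * (J%:R + 1) `^ (2 + g))).
  have p0 : 0 <= 2 * e * `|s| by rewrite mulr_ge0// mulr_ge0// ltW.
  apply: (le_trans (ler_wpM2l p0 (delay_error_le k))).
  rewrite mulr_sumr -/J.
  apply: (@le_trans _ _ (\sum_(n < k | (k - J <= n)%N)
    (q * (lag_decay R g (k - n) * `|increment n| ^+ 2) +
     e ^+ 2 * `|s| ^+ 2 * (q^-1 * (lag_decay R g (k - n))^-1)))).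
    by apply: ler_sum => n _; exact: Hyoung.
  rewrite big_split /= lerD//.
    rewrite -mulr_sumr ler_wpM2l ?(ltW q0)// big_mkcond /=; apply: ler_sum => n _.
    case: ifP => // _; rewrite mulr_ge0 ?sqr_ge0// ltW// lag_decay_gt0//.
    by rewrite subn_gt0.
  have es0 : 0 <= e ^+ 2 * `|s| ^+ 2 by rewrite mulr_ge0 ?sqr_ge0.
  rewrite -mulr_sumr; apply: ler_wpM2l => //; rewrite -mulr_sumr.
  rewrite ler_wpM2l ?invr_ge0 ?(ltW q0)//.
  rewrite (sum_window _ (fun n => (lag_decay R g (k - n))^-1)).
  apply: le_trans (sum_inv_lag_decay R g k J g0).
  rewrite le_eqVlt; apply/orP; left; apply/eqP; apply: eq_bigr => l _.
  by rewrite subKn.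
(* This identity turns the total of the [e ^+ 2] terms into [c * (e * |s| ^+ 2)], leaving the
   fraction [1 - c] of the cocoercivity gain. *)
have He : e * step_denom R m g J = c.
  by rewrite /e etaE step_sizeE divfK// gt_eqF// step_denom_gt0.
have : e ^+ 2 * `|s| ^+ 2 * step_denom R m g J = c * (e * `|s| ^+ 2).
  by rewrite -He; ring.
rewrite /step_denom -/q.
set B := (2 + g)^-1 * _ in Hsum *; set S := \sum_(n < k) _ in Hsum *.
set es := e ^+ 2 * `|s| ^+ 2 in Hsum *; set E := e * `|s| ^+ 2 in Hdot *.
lra.
Qed.

End path.
Arguments increment {R H} x k.
Arguments residual {R H m} V T jv x k.
Arguments arock_step {R H dot} hdot {m V} hV {T x0 eta b jv x} hx k.
Arguments norm_increment_le {R H dot} hdot {m V} hV {T x0 eta b jv x} hx k.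
Arguments delay_error_le {R H dot} hdot {m V} hV {T x0 eta b jv x} hx k.
Arguments descent {R H dot} hdot {m V} hV {T x0 eta b jv x} hT hx {c g z} k.

(** * The potential and its consequences along one trajectory *)

Section potential.
Context (R : realType) (H : completeNormedModType R) (dot : {dot H for idfun}).
Hypothesis hdot : inner_product_of_norm dot.
Context (m : nat) (V : 'I_m -> set H).
Hypothesis hV : orthogonal_decomposition dot V.
Context (T : H -> H) (x0 : H) (jv : nat -> 'I_m -> nat) (c g : R) (z : H).
Hypotheses (m0 : (0 < m)%N) (hc : 0 < c < 1) (g0 : 0 < g).
Hypotheses (hT : nonexpansive T) (Tz : T z = z).
Local Notation eta := (step_size c g jv).

Definition lyapunov (x : nat -> H) (k : nat) : R :=
  `|x k - z| ^+ 2 + (Num.sqrt m%:R)^-1 *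
    \sum_(n < k) lag_weight R g (k - n) * `|increment x n| ^+ 2.

(** Adding the decrease already secured to [lyapunov] leaves a plain supermartingale, whose
    convergence also bounds the residual sum. *)
Definition potential (x : nat -> H) (k : nat) : R :=
  lyapunov x k +
  (1 - c) / m%:R * \sum_(n < k) eta n * `|residual V T jv x n| ^+ 2.

Lemma lyapunov_ge0 x k : 0 <= lyapunov x k.
Proof.
rewrite addr_ge0 ?sqr_ge0// mulr_ge0 ?invr_ge0 ?sqrtr_ge0// sumr_ge0// => n _.
by rewrite mulr_ge0 ?sqr_ge0// lag_weight_ge0.
Qed.

Lemma eta_residual_ge0 x n : 0 <= eta n * `|residual V T jv x n| ^+ 2.
Proof. by rewrite mulr_ge0 ?sqr_ge0// ltW// step_size_gt0. Qed.

Lemma scaling_gt0 : 0 < (1 - c) / m%:R.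
Proof. by rewrite divr_gt0 ?ltr0n// subr_gt0; case/andP: hc. Qed.

Lemma potential_ge0 x k : 0 <= potential x k.
Proof.
rewrite addr_ge0 ?lyapunov_ge0// mulr_ge0 ?(ltW scaling_gt0)// sumr_ge0// => n _.
exact: eta_residual_ge0.
Qed.

Lemma sum_potential_le (x : nat -> H) (y : 'I_m -> nat -> H) (b : nat -> 'I_m) k :
  arock V T x0 eta b jv x ->
  (forall i n, (n <= k)%N -> y i n = x n) ->
  (forall i, y i k.+1 = x k - eta k *: block V i (residual V T jv x k)) ->
  \sum_i potential (y i) k.+1 <= m%:R * potential x k.
Proof.
move=> hx yx yS.
have m0' : 0 < m%:R :> R by rewrite ltr0n.
set s := residual V T jv x k in yS *; set e := eta k in yS *.
pose q : R := Num.sqrt m%:R; have q0 : 0 < q by exact: sqrt_dim_gt0.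
have qm : q * q = m%:R by rewrite -expr2 sqr_sqrtr// ltW.
pose A := \sum_(n < k) lag_weight R g (k.+1 - n) * `|increment x n| ^+ 2.
pose B := \sum_(n < k) eta n * `|residual V T jv x n| ^+ 2.
have yP i : potential (y i) k.+1 =
    `|x k - e *: block V i s - z| ^+ 2 +
    q^-1 * (A + (1 + g^-1) * (e ^+ 2 * `|block V i s| ^+ 2)) +
    (1 - c) / m%:R * (B + e * `|s| ^+ 2).
  rewrite /potential /lyapunov yS !big_ord_recr /= subSnn -/q.
  have incE n : (n < k)%N -> increment (y i) n = increment x n.
    by move=> nk; rewrite /increment !yx// ltnW.
  have resE n : (n <= k)%N -> residual V T jv (y i) n = residual V T jv x n.
    move=> nk; rewrite /residual (_ : delayed_iterate V jv (y i) n = delayed_iterate V jv x n)//.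
    by apply: eq_bigr => l _; rewrite yx// (leq_trans (leq_subr _ _)).
  congr (_ + _ * (_ + _) + _ * (_ + _)).
  - by apply: eq_bigr => n _; rewrite incE.
  - rewrite /increment yS yx// addrC addKr normrN normrZ exprMn real_normK ?num_real//.
  - by apply: eq_bigr => n _; rewrite resE// ltnW.
  - by rewrite resE.
under eq_bigr => i _ do rewrite yP.
rewrite big_split /= big_split /= sumr_const card_ord -mulr_sumr big_split /=.
rewrite sumr_const card_ord -mulr_sumr -mulr_sumr (sum_norm_block hdot hV).
rewrite (sum_norm_step hdot hV).
have := descent hdot hV hT hx k hc g0 m0 Tz erefl.
rewrite -/s -/e -/q.
(* In [A] every lag has grown by one; the resulting drop covers the right side of [descent], with
   [q = m / q]. *)
have : q * (\sum_(n < k) lag_decay R g (k - n) * `|increment x n| ^+ 2) <=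
    q * (\sum_(n < k) lag_weight R g (k - n) * `|increment x n| ^+ 2 - A).
  rewrite ler_wpM2l ?(ltW q0)// /A -sumrB; apply: ler_sum => n _.
  rewrite -mulrBl ler_wpM2r ?sqr_ge0// subSn; last exact: ltnW.
  by apply: lag_weight_decr; rewrite ?subn_gt0.
rewrite /potential /lyapunov -/q -/B.
set S := \sum_(n < k) lag_decay _ _ _ * _; set W := \sum_(n < k) lag_weight _ _ (k - n) * _.
set X := `|x k - z| ^+ 2; set D := dot _ _; set s2 := `|s| ^+ 2.
have -> : m%:R * (X + q^-1 * W + (1 - c) / m%:R * B) =
    m%:R * X + q * W + (1 - c) * B.
  by rewrite -qm; field; rewrite gt_eqF.
rewrite -(mulr_natl A m) -(mulr_natl ((1 - c) / m%:R * (B + e * s2)) m).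
have -> : m%:R * ((1 - c) / m%:R * (B + e * s2)) = (1 - c) * (B + e * s2).
  by field; rewrite gt_eqF.
have -> : q^-1 * (m%:R * A + (1 + g^-1) * (e ^+ 2 * s2)) =
    q * A + q^-1 * ((1 + g^-1) * (e ^+ 2 * s2)).
  by rewrite -qm; field; rewrite !gt_eqF.
lra.
Qed.

Section convergent.
Context (x : nat -> H) (b : nat -> 'I_m).
Hypothesis hx : arock V T x0 eta b jv x.
Hypothesis cpot : cvgn (potential x).

Lemma sum_residual_bounded :
  exists B, forall k, \sum_(n < k) eta n * `|residual V T jv x n| ^+ 2 <= B.
Proof.
have [B [_ hB]] := cvg_seq_bounded cpot.
exists ((B + 1) / ((1 - c) / m%:R)) => k; rewrite ler_pdivlMr ?scaling_gt0// mulrC.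
have := hB (B + 1) _ k I; rewrite /= ltrDl => /(_ ltr01); rewrite ger0_norm ?potential_ge0//.
by apply: le_trans; rewrite lerDr lyapunov_ge0.
Qed.

Lemma norm_increment_sq_le n :
  `|increment x n| ^+ 2 <= eta n * `|residual V T jv x n| ^+ 2.
Proof.
have e0 : 0 <= eta n by rewrite ltW// step_size_gt0.
have := norm_increment_le hdot hV hx n.
rewrite (ger0_norm e0) => h.
apply: (@le_trans _ _ ((eta n * `|residual V T jv x n|) ^+ 2)).
  by rewrite ler_sqr ?nnegrE// mulr_ge0.
by rewrite exprMn expr2 ler_wpM2r ?sqr_ge0// -[leRHS]mulr1 ler_wpM2l// step_size_le1.
Qed.

(** The residual sum is monotone and bounded, and [weighted_sum_cvg] handles the lag sum;
    subtracting both from the potential leaves the squared distance. *)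
Lemma dist_fix_cvg : cvg (`|x k - z| @[k --> \oo]).
Proof.
have [B hB] := sum_residual_bounded.
have [cr _] := bounded_sum_cvg R _ B (eta_residual_ge0 x) hB.
have cw : cvgn (fun k => \sum_(n < k) lag_weight R g (k - n) * `|increment x n| ^+ 2).
  apply: (@weighted_sum_cvg R (lag_weight R g) (fun n => `|increment x n| ^+ 2) B) => [l|l|n|k].
  - exact: lag_weight_ge0.
  - exact: lag_weight_le.
  - exact: sqr_ge0.
  - by rewrite (le_trans _ (hB k))//; apply: ler_sum => n _; exact: norm_increment_sq_le.
have csq : cvgn (fun k => `|x k - z| ^+ 2).
  rewrite (_ : (fun k => _) = (fun k => potential x k -
     (Num.sqrt m%:R)^-1 * (\sum_(n < k) lag_weight R g (k - n) * `|increment x n| ^+ 2) -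
     (1 - c) / m%:R * \sum_(n < k) eta n * `|residual V T jv x n| ^+ 2)).
    have lin (p u v : nat -> R) (a a' : R) : cvgn p -> cvgn u -> cvgn v ->
        cvgn (fun k => p k - a * u k - a' * v k).
      move=> cp cu cv; apply: is_cvgB; last exact: is_cvgMl_tmp.
      by apply: is_cvgB => //; exact: is_cvgMl_tmp.
    exact: (lin _ _ _ _ _ cpot cw cr).
  by apply/funext => k; rewrite /potential /lyapunov; ring.
have /cvg_ex[l hl] := csq.
apply/cvg_ex; exists (Num.sqrt l).
rewrite (_ : (fun k => _) = (fun k => Num.sqrt (`|x k - z| ^+ 2))).
  exact: (cvg_comp (fun k => `|x k - z| ^+ 2) _ hl (@sqrt_continuous R l)).
by apply/funext => k; rewrite sqrtr_sqr ger0_norm.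
Qed.

(** Steps bounded below make the delayed residuals vanish, and the delay error is at most a sum of
    [J] vanishing increments; by nonexpansiveness, passing to the current iterate costs twice that
    error. *)
Lemma fixed_point_residual_cvg (f : nat -> nat) (J : nat) :
  f @ \oo --> \oo -> (forall n, (current_delay jv (f n) <= J)%N) ->
  `|x (f n) - T (x (f n))| @[n --> \oo] --> 0.
Proof.
move=> foo fJ.
have [B hB] := sum_residual_bounded.
have [_ r0] := bounded_sum_cvg R _ B (eta_residual_ge0 x) hB.
have inc0 : `|increment x n| @[n --> \oo] --> 0.
  apply: sqr_cvg0 => //; apply: (squeeze_cvgr _ (cvg_cst 0) r0).
  by apply: nearW => n; rewrite sqr_ge0 norm_increment_sq_le.
have e0 : 0 < c / step_denom R m g J.
  by rewrite divr_gt0 ?step_denom_gt0//; case/andP: hc.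
have res0 : `|residual V T jv x (f n)| @[n --> \oo] --> 0.
  apply: sqr_cvg0 => //.
  have hub : (c / step_denom R m g J)^-1 *
      (eta (f n) * `|residual V T jv x (f n)| ^+ 2) @[n --> \oo] --> 0.
    rewrite -[X in _ --> X](mulr0 (c / step_denom R m g J)^-1).
    apply: cvgMl_tmp; exact: (cvg_comp f _ foo r0).
  apply: (squeeze_cvgr _ (cvg_cst 0) hub).
  apply: nearW => n; rewrite sqr_ge0 /= mulrA -[leLHS]mul1r ler_wpM2r ?sqr_ge0//.
  by rewrite mulrC ler_pdivlMr// mul1r step_size_ge.
have shift l : `|increment x (f n - l.+1)%N| @[n --> \oo] --> 0.
  apply: (cvg_comp (fun n => (f n - l.+1)%N) _ _ inc0).
  move=> A [N _ NA].
  have h : (f @ \oo) [set k | (N + l.+1 <= k)%N] by apply: foo; exists (N + l.+1)%N.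
  by have [M _ hM] := h; exists M => // n /hM /= Nf; apply: NA => /=; lia.
have hub : `|residual V T jv x (f n)| +
    2 * \sum_(l < J) `|increment x (f n - l.+1)%N| @[n --> \oo] --> 0.
  have s0 K : \sum_(l < K) `|increment x (f n - l.+1)%N| @[n --> \oo] --> 0.
    elim: K => [|K IH]; first by under eq_fun do rewrite big_ord0; exact: cvg_cst.
    rewrite (_ : (fun n => _) = (fun n => \sum_(l < K) `|increment x (f n - l.+1)%N| +
        `|increment x (f n - K.+1)%N|)).
      by rewrite -[X in _ --> X](addr0 0); apply: cvgD.
    by apply/funext => n; rewrite big_ord_recr.
  rewrite -[X in _ --> X](addr0 0) -[X in _ --> _ + X](mulr0 2).
  by apply: cvgD => //; exact: cvgMl_tmp.
apply: (squeeze_cvgr _ (cvg_cst 0) hub); apply: nearW => n; rewrite normr_ge0 /=.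
have derr : `|x (f n) - delayed_iterate V jv x (f n)| <=
    \sum_(l < J) `|increment x (f n - l.+1)%N|.
  apply: (le_trans (delay_error_le hdot hV hx (f n))).
  rewrite (sum_window _ (fun l => `|increment x l|)).
  exact: (sum_ord_cond_le _ (fun l => `|increment x (f n - l.+1)%N|)).
have /= := hT (x (f n)) (delayed_iterate V jv x (f n)); move: derr.
set d := `|x (f n) - _|; set S := \sum_(l < J) _; move=> derr Tle.
apply: (@le_trans _ _ (`|residual V T jv x (f n)| + 2 * d)); last by rewrite lerD2l ler_wpM2l.
rewrite /residual; set xh := delayed_iterate _ _ _ _ in d Tle derr *.
have -> : x (f n) - T (x (f n)) = (xh - T xh) + ((x (f n) - xh) - (T (x (f n)) - T xh)).
  have -> : x (f n) - xh - (T (x (f n)) - T xh) = x (f n) - T (x (f n)) - (xh - T xh).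
    by rewrite !opprD addrACA.
  by rewrite [RHS]addrC subrK.
apply: (le_trans (ler_normD _ _)); rewrite lerD2l.
by apply: (le_trans (ler_normB _ _)); rewrite mulr_natl mulr2n lerD2l.
Qed.

End convergent.
End potential.
Arguments potential {R H m} V T jv c g z x k.
Arguments potential_ge0 {R H m} V T jv {c g} z m0 hc g0 x k.
Arguments sum_potential_le {R H dot} hdot {m V} hV {T x0 jv c g z} m0 hc g0 hT Tz {x} y {b k} hx.
Arguments dist_fix_cvg {R H dot} hdot {m V} hV {T x0 jv c g z} m0 hc g0 {x b} hx cpot.
Arguments fixed_point_residual_cvg {R H dot} hdot {m V} hV {T x0 jv c g z}
  m0 hc g0 hT {x b} hx cpot {f J}.

(** * The potential as a supermartingale of the block history *)

Section stochastic.
Context (R : realType) (H : completeNormedModType R) (dot : {dot H for idfun}).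
Hypothesis hdot : inner_product_of_norm dot.
Context (m : nat) (V : 'I_m -> set H).
Hypothesis hV : orthogonal_decomposition dot V.
Context (T : H -> H) (d : measure_display) (Omega : measurableType d).
Context (ib : nat -> Omega -> 'I_m) (jv : nat -> 'I_m -> nat) (c g : R).
Context (x0 : H) (x : nat -> Omega -> H).
Hypothesis hx : forall w,
  arock V T x0 (step_size c g jv) (ib^~ w) jv (x^~ w).

Lemma arock_determined k w w' : hist ib w k = hist ib w' k ->
  forall l, (l <= k)%N -> x l w = x l w'.
Proof.
elim: k => [|k IH] e l.
  by rewrite leqn0 => /eqP ->; case: (hx w) => ->; case: (hx w') => ->.
have [e' eb] : hist ib w k = hist ib w' k /\ ib k w = ib k w'.
  by move: e; rewrite !histS => /rcons_inj[].
rewrite leq_eqVlt => /orP[/eqP ->|]; last by rewrite ltnS; exact: IH.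
rewrite (arock_step hdot hV (hx w)) (arock_step hdot hV (hx w')) eb (IH e' k)//.
congr (_ - _ *: block V _ _); rewrite /residual.
rewrite (_ : delayed_iterate V jv (x^~ w) k = delayed_iterate V jv (x^~ w') k)//.
by apply: eq_bigr => i _; rewrite (IH e')// leq_subr.
Qed.

Lemma potential_adapted z :
  block_adapted ib (fun k w => potential V T jv c g z (x^~ w) k).
Proof.
move=> k w w' e; have xx := arock_determined k w w' e.
have incE n : (n < k)%N -> increment (x^~ w) n = increment (x^~ w') n.
  by move=> nk; rewrite /increment !xx// ltnW.
have resE n : (n < k)%N -> residual V T jv (x^~ w) n = residual V T jv (x^~ w') n.
  move=> nk; rewrite /residual.
  rewrite (_ : delayed_iterate V jv (x^~ w) n = delayed_iterate V jv (x^~ w') n)//.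
  by apply: eq_bigr => i _; rewrite xx// (leq_trans (leq_subr _ _))// ltnW.
rewrite /potential /lyapunov xx//; congr (_ + _ * _ + _ * _).
  by apply: eq_bigr => n _; rewrite incE.
by apply: eq_bigr => n _; rewrite resE.
Qed.

Lemma potential_supermartingale z :
  (0 < m)%N -> 0 < c < 1 -> 0 < g -> nonexpansive T -> T z = z ->
  block_supermartingale ib (fun k w => potential V T jv c g z (x^~ w) k).
Proof.
move=> m0 hc g0 hT Tz k w v hv.
have hk i : hist ib (v i) k = hist ib w k /\ ib k (v i) = i.
  by have := hv i; rewrite histS => /rcons_inj[].
have xx i n : (n <= k)%N -> x n (v i) = x n w.
  by apply: arock_determined; case: (hk i).
apply: (sum_potential_le hdot hV m0 hc g0 hT Tz (fun i => x^~ (v i)) (hx w)) => // i.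
rewrite (arock_step hdot hV (hx (v i))) xx// (hk i).2.
congr (_ - _ *: block V _ _); rewrite /residual.
rewrite (_ : delayed_iterate V jv (x^~ (v i)) k = delayed_iterate V jv (x^~ w) k)//.
by apply: eq_bigr => l _; rewrite xx// leq_subr.
Qed.

End stochastic.

Theorem theorem2 (R : realType)
    (H : completeNormedModType R) (dot : {dot H for idfun})
    (m : nat) (V : 'I_m -> set H) (T : H -> H)
    (d : measure_display) (Omega : measurableType d) (P : probability Omega R)
    (ib : nat -> Omega -> 'I_m) (jv : nat -> 'I_m -> nat)
    (c gamma : R) (x0 : H) (x : nat -> Omega -> H)
    (hdot : inner_product_of_norm dot)
    (hsep : separable H)
    (hm : (0 < m)%N)
    (hV : orthogonal_decomposition dot V)
    (hT : nonexpansive T)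
    (hfix : Fix T !=set0)
    (hib : iid_uniform P ib)
    (hliminf : (liminf_nat R (current_delay jv) < +oo)%E)
    (hc : 0 < c < 1) (hgamma : 0 < gamma)
    (hx : forall w : Omega,
      arock V T x0 (step_size c gamma jv) (fun k => ib k w) jv
        (fun k => x k w)) :
  {ae P, forall w : Omega,
    exists xstar : H, Fix T xstar /\
      forall J : nat, (liminf_nat R (current_delay jv) <= (J%:R)%:E)%E ->
        weakly_cvg dot
          (bounded_delay_subseq (fun k => x k w) (current_delay jv) J) xstar}.
Proof.
have [z [Tz zdense]] := separable_dense_seq R H (Fix T) hsep hfix.
have : {ae P, forall w, forall n, cvgn (potential V T jv c gamma (z n) (x^~ w))}.
  apply: ae_foralln => n.
  apply: (supermartingale_cvg hib (fun k w => potential V T jv c gamma (z n) (x^~ w) k)) => //.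
  - by move=> k w; exact: potential_ge0.
  - exact: (potential_adapted R H dot hdot m V hV T d Omega ib jv c gamma x0 x hx).
  - apply: (potential_supermartingale R H dot hdot m V hV T d Omega ib jv c gamma x0 x hx) => //.
    exact: Tz.
apply: filterS => w cpot.
have cz n : cvg (`|x k w - z n| @[k --> \oo]).
  exact: (dist_fix_cvg hdot hV hm hc hgamma (hx w) (cpot n)).
have cfix : forall p, T p = p -> cvg (`|x k w - p| @[k --> \oo]).
  exact: (dist_cvg_dense R H (Fix T) (x^~ w) z zdense cz).
have [l [Tl wl]] := opial R H dot hdot T (x^~ w) hT hfix cfix.
exists l; split => // J hJ.
have infJ := frequently_le_of_liminf R (current_delay jv) J hJ.
have kept := kept_indexP _ _ infJ.
apply: (wl _ (kept_index_cvg _ _ infJ)).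
(* The residual sum does not involve the fixed point, so the potential at [z 0] suffices. *)
apply: (fixed_point_residual_cvg hdot hV hm hc hgamma hT (hx w) (cpot 0%N) (J := J)).
  exact: kept_index_cvg.
by move=> n; case: (kept n).
Qed.
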